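(* Let $n>1$ and $1<p\le q<n/\Theta_{p,q}(1)$ with $\Theta_{p,q}(1):=1+n\left(\frac1q-\frac1p\right)>0$. Fix a weakly porous set $E\subset\mathbb{R}^n$ with $0<\operatorname{diam}(E)<\infty$ and $\beta>0$ with $\beta p'/p<\mathrm{Mu}_1(E)$. Then there exists $C>0$ such that $$\left(\int_{D(\kappa)}|f(x)|^q\,d(x,E)^{q(n-p+\beta)/p-n}\,dx\right)^{1/q}\le C\,\kappa^{-\Theta_{p,q}(1)}\left(\int_{\mathbb{R}^n}|\nabla f(x)|^p\,d(x,E)^{\beta}\,dx\right)^{1/p}$$ for every $f\in C_0^1(\mathbb{R}^n)$ and $0<\kappa<1$, where $D(\kappa):=\{x\in\mathbb{R}^n:d(x,E)\ge\kappa\operatorname{diam}(E)\}$.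
   Context: Here $p'=p/(p-1)$, $d(x,E)=\inf\{|x-y|:y\in E\}$ and $\operatorname{diam}(E)=\sup\{|x-y|:x,y\in E\}$. $C_0^1(\mathbb{R}^n)$ denotes the class of continuously differentiable functions on $\mathbb{R}^n$ vanishing at $\infty$. The class $A_1(\mathbb{R}^n)$ consists of the weights $w$ (i.e. $w\in L^1_{\rm loc}(\mathbb{R}^n)$, $w\ge0$ a.e.) with $\sup_Q\left(\frac{1}{|Q|}\int_Q w\right)\left(\operatorname{ess\,inf}_Q w\right)^{-1}<\infty$, the supremum over all cubes $Q\subset\mathbb{R}^n$. A nonempty set $E\subset\mathbb{R}^n$ is weakly porous if there exists $\alpha>0$ with $d(\cdot,E)^{-\alpha}\in A_1(\mathbb{R}^n)$; for such $E$ the Muckenhoupt exponent is $\mathrm{Mu}_1(E)=\sup\{\alpha>0:d(\cdot,E)^{-\alpha}\in A_1(\mathbb{R}^n)\}>0$. *)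

(* Defs.v *)
From HB Require Import structures.
From mathcomp Require Import all_boot all_order all_algebra.
From mathcomp Require Import all_classical all_reals all_analysis.
From mathcomp Require Import measurable_realfun ess_sup_inf.

Set Implicit Arguments.
Unset Strict Implicit.
Unset Printing Implicit Defensive.

Import Order.TTheory GRing.Theory Num.Theory.
Import numFieldNormedType.Exports.

Local Open Scope classical_set_scope.
Local Open Scope ring_scope.

(* The product sigma-algebra on row vectors, as for tuples in the library;
   over R it is the Borel sigma-algebra of R^n. *)
Definition measure_rV_display : measure_display -> measure_display.
Proof. exact. Qed.

Section measurable_rV.
Context {d} {T : measurableType d} {n : nat}.

Let coors : 'I_n -> 'rV[T]_n -> T := fun i v => v ord0 i.

Let rV_set0 : g_sigma_preimage coors set0.
Proof. exact: sigma_algebra0. Qed.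

Let rV_setC A : g_sigma_preimage coors A -> g_sigma_preimage coors (~` A).
Proof. exact: sigma_algebraC. Qed.

Let rV_bigcup (F : _^nat) : (forall i, g_sigma_preimage coors (F i)) ->
  g_sigma_preimage coors (\bigcup_i (F i)).
Proof. exact: sigma_algebra_bigcup. Qed.

HB.instance Definition _ := @isMeasurable.Build (measure_rV_display d)
  'rV[T]_n (g_sigma_preimage coors) rV_set0 rV_setC rV_bigcup.

Lemma measurable_coord (i : 'I_n) :
  measurable_fun [set: 'rV[T]_n] (fun v : 'rV[T]_n => v ord0 i).
Proof.
move=> _ Y mY; rewrite setTI; apply: sub_sigma_algebra => /=.
rewrite -bigcup_seq/=; exists i => /=; first by rewrite mem_index_enum.
by exists Y => //; rewrite setTI.
Qed.

End measurable_rV.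

Lemma measurable_fun_rV d d' (T : measurableType d) (U : measurableType d')
    n (f : U -> 'rV[T]_n) :
  (forall i, measurable_fun [set: U] (fun u => f u ord0 i)) ->
  measurable_fun [set: U] f.
Proof.
move=> mf _ Y mY; rewrite setTI.
suff : image_set_system setT f (@measurable _ U) Y.
  by rewrite /image_set_system /= setTI.
apply: mY; split.
  exact/sigma_algebra_image/sigma_algebra_measurable.
move=> A; rewrite -bigcup_seq /= => -[i _ [B mB <-]].
rewrite /image_set_system /= !setTI -[X in measurable X]setTI.
exact: (mf i measurableT _ mB).
Qed.

Section rV_cons.
Context {R : realType} {n : nat}.

Definition rV_cons (p : measurableTypeR R * 'rV[R]_n) : 'rV[R]_n.+1 :=
  row_mx ((p.1 : R)%:M) p.2.

Definition rV_behead (v : 'rV[R]_n.+1) : 'rV[R]_n :=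
  \row_i v ord0 (lift ord0 i).

Lemma rV_cons0 p : rV_cons p ord0 ord0 = p.1.
Proof.
transitivity (rV_cons p ord0 (lshift n (ord0 : 'I_1))).
  by congr (rV_cons p _ _); exact: val_inj.
by rewrite [LHS]row_mxEl mxE eqxx mulr1n.
Qed.

Lemma rV_consS p i : rV_cons p ord0 (lift ord0 i) = p.2 ord0 i.
Proof.
transitivity (rV_cons p ord0 (rshift 1 i)).
  by congr (rV_cons p _ _); exact: val_inj.
by rewrite [LHS]row_mxEr.
Qed.

Lemma rV_consK p : rV_behead (rV_cons p) = p.2.
Proof. by apply/rowP => i; rewrite mxE rV_consS. Qed.

Lemma measurable_rV_cons : measurable_fun [set: _] rV_cons.
Proof.
apply: measurable_fun_rV => i; have [j ->|->] := unliftP ord0 i.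
- rewrite (_ : (fun _ => _) = (fun v : 'rV[R]_n => v ord0 j) \o snd).
    by apply: measurableT_comp => //; exact: measurable_coord.
  by apply/funext => p /=; rewrite rV_consS.
- rewrite (_ : (fun _ => _) = fst); first exact: measurable_fst.
  by apply/funext => p /=; rewrite rV_cons0.
Qed.

Lemma measurable_rV_behead : measurable_fun [set: _] rV_behead.
Proof.
apply: measurable_fun_rV => i.
rewrite (_ : (fun _ => _) = (fun v : 'rV[R]_n.+1 => v ord0 (lift ord0 i))).
  exact: measurable_coord.
by apply/funext => v; rewrite mxE.
Qed.

End rV_cons.

Section lebesgue_rV_step.
Local Open Scope ereal_scope.
Context {R : realType} {n : nat}.
Variable mu : {sigma_finite_measure set 'rV[R]_n -> \bar R}.

Definition lebesgue_rV_step : set 'rV[R]_n.+1 -> \bar R :=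
  pushforward (lebesgue_measure \x mu) rV_cons.

Let step0 : lebesgue_rV_step set0 = 0.
Proof. by rewrite /lebesgue_rV_step /pushforward preimage_set0 measure0. Qed.

Let step_ge0 A : 0 <= lebesgue_rV_step A.
Proof. by rewrite /lebesgue_rV_step /pushforward; apply: measure_ge0. Qed.

Let step_sigma_additive : semi_sigma_additive lebesgue_rV_step.
Proof.
have mf A : measurable A -> measurable (rV_cons @^-1` A).
  by move=> mA; rewrite -[X in measurable X]setTI; exact: measurable_rV_cons.
move=> F mF tF mUF; rewrite /lebesgue_rV_step /pushforward preimage_bigcup.
apply: measure_semi_sigma_additive.
- by move=> k; exact: mf.
- apply/trivIsetP => i j _ _ ij; rewrite -preimage_setI.
  by move/trivIsetP : tF => /(_ _ _ Logic.I Logic.I ij) ->; rewrite preimage_set0.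
- by rewrite -preimage_bigcup; exact: mf.
Qed.

HB.instance Definition _ := isMeasure.Build _ _ _ lebesgue_rV_step
  step0 step_ge0 step_sigma_additive.

Lemma lebesgue_rV_stepE (A : set (measurableTypeR R)) (B : set 'rV[R]_n) :
  measurable A -> measurable B ->
  lebesgue_rV_step [set v : 'rV[R]_n.+1 | A (v ord0 ord0) /\ B (rV_behead v)] =
  lebesgue_measure A * mu B.
Proof.
move=> mA mB; rewrite -product_measure1E//; congr (product_measure1 _ _ _).
by apply/funext => p /=; rewrite rV_cons0 rV_consK.
Qed.

Let step_sigma_finite : sigma_finite [set: 'rV[R]_n.+1] lebesgue_rV_step.
Proof.
have /sigma_finiteP[F [TF ndF Foo]] := sigma_finiteT (@lebesgue_measure R).
have /sigma_finiteP[G [TG ndG Goo]] := sigma_finiteT mu.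
exists (fun k => [set v : 'rV[R]_n.+1 | F k (v ord0 ord0) /\ G k (rV_behead v)]).
  apply/esym; rewrite -subTset => v _.
  have [i _ Fi] : (\bigcup_i F i) (v ord0 ord0) by rewrite -TF.
  have [j _ Gj] : (\bigcup_i G i) (rV_behead v) by rewrite -TG.
  exists (maxn i j) => //; split.
  - by move: Fi; exact/subsetPset/ndF/leq_maxl.
  - by move: Gj; exact/subsetPset/ndG/leq_maxr.
move=> k; have [mF Fk] := Foo k; have [mG Gk] := Goo k; split.
  apply: measurableI; rewrite -[X in measurable X]setTI.
    exact: (measurable_coord (T := R) ord0).
  exact: measurable_rV_behead.
by rewrite lebesgue_rV_stepE// lte_mul_pinfty// ge0_fin_numE.
Qed.

HB.instance Definition _ := Measure_isSigmaFinite.Build _ _ _ lebesgue_rV_step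
  step_sigma_finite.

End lebesgue_rV_step.

(* Lebesgue measure on R^n, as the n-fold product of the one-dimensional one;
   lebesgue_rV_box gives its value on boxes, which determines it. *)
Fixpoint lebesgue_rV (R : realType) (n : nat) :
    {sigma_finite_measure set 'rV[R]_n -> \bar R} :=
  match n with
  | 0 => \d_(0 : 'rV[R]_0)
  | m.+1 => lebesgue_rV_step (lebesgue_rV R m)
  end.

Lemma lebesgue_rV_box (R : realType) (n : nat) (a b : 'rV[R]_n) :
  (forall i, a ord0 i <= b ord0 i) ->
  lebesgue_rV R n [set v | forall i, a ord0 i <= v ord0 i <= b ord0 i] =
  (\prod_(i < n) (b ord0 i - a ord0 i))%:E.
Proof.
elim: n a b => [|n IH] a b ab.
  rewrite big_ord0 -(diracT R (0 : 'rV[R]_0)) /=; congr dirac.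
  by apply/seteqP; split => v // _ [].
rewrite big_ord_recl /= (_ : (fun _ => _) = [set v : 'rV[R]_n.+1 |
    `[a ord0 ord0, b ord0 ord0]%classic (v ord0 ord0) /\
    [set w : 'rV[R]_n | forall i, (rV_behead a) ord0 i <= w ord0 i
       <= (rV_behead b) ord0 i] (rV_behead v)]); last first.
  apply/seteqP; split => v /=.
    by move=> h; split => [|i]; [rewrite in_itv/=; exact: h|rewrite !mxE].
  move=> [h0 hS] i; have [j ->|->] := unliftP ord0 i.
    by have := hS j; rewrite !mxE.
  by move: h0; rewrite in_itv.
rewrite lebesgue_rV_stepE; last 2 first.
- exact: measurable_itv.
- rewrite (_ : mkset _ = \bigcap_(i in [set: 'I_n])
      ((fun v : 'rV[R]_n => v ord0 i) @^-1`
         `[(rV_behead a) ord0 i, (rV_behead b) ord0 i])).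
    apply: fin_bigcap_measurable => // i _.
    by rewrite -[X in measurable X]setTI; exact: measurable_coord.
  apply/seteqP; split => v /= h i; first by move=> _; rewrite /= in_itv/=.
  by have := h i I; rewrite /= in_itv.
rewrite IH; last by move=> i; rewrite !mxE.
have := ab ord0; rewrite lebesgue_measure_itv /= lte_fin le_eqVlt.
under eq_bigr do rewrite !mxE.
move=> /predU1P[->|->]; last by rewrite EFinM.
by rewrite ltxx mul0e subrr mul0r.
Qed.

Section euclidean.
Context {R : realType} {n : nat}.
Implicit Types (v x : 'rV[R]_n) (E : set 'rV[R]_n).

(* The library norm on 'rV[R]_n is the sup norm. *)
Definition enorm v : R := Num.sqrt (\sum_(i < n) v ord0 i ^+ 2).

Definition dist x E : R := inf [set enorm (x - y) | y in E].

Definition diam E : \bar R :=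
  ereal_sup [set (enorm (x - y))%:E | x in E & y in E].

(* d(x, E) ^ a, with the value +oo where d(x, E) = 0 and a < 0; the real
   power function of the library is 0 there. *)
Definition dist_pow E (a : R) x : \bar R :=
  if (dist x E == 0) && (a < 0) then +oo%E else (dist x E `^ a)%:E.

Definition cube (a : 'rV[R]_n) (l : R) : set 'rV[R]_n :=
  [set x | forall i, a ord0 i <= x ord0 i <= a ord0 i + l].

Lemma measurable_cube a l : measurable (cube a l).
Proof.
rewrite (_ : cube a l = \bigcap_(i in [set: 'I_n])
    ((fun v : 'rV[R]_n => v ord0 i) @^-1` `[a ord0 i, a ord0 i + l])).
  apply: fin_bigcap_measurable => // i _.
  by rewrite -[X in measurable X]setTI; exact: measurable_coord.
apply/seteqP; split => v /= h i; first by move=> _; rewrite /= in_itv/=.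
by have := h i I; rewrite /= in_itv.
Qed.

End euclidean.

Section muckenhoupt.
Local Open Scope ereal_scope.
Context {R : realType} {n : nat}.
Implicit Types (w : 'rV[R]_n -> \bar R) (E : set 'rV[R]_n).
Local Notation mu := (lebesgue_rV R n).

Definition weight w :=
  [/\ measurable_fun [set: 'rV[R]_n] w,
      forall K : set 'rV[R]_n, compact K -> \int[mu]_(x in K) `|w x| < +oo &
      {ae mu, forall x, 0 <= w x}].

(* Cubes are closed with sides parallel to the axes. In \bar R the inverse of 0
   is +oo and that of +oo is 0; the latter never makes A1_constant finite
   wrongly, as a locally integrable w has a finite essential infimum. *)
Definition A1_constant w : \bar R :=
  ereal_sup [set (\int[mu]_(x in cube a l) w x) / mu (cube a l) *
                 (ess_inf (mrestr mu (measurable_cube a l)) w)^-1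
            | a in [set: 'rV[R]_n] & l in [set l : R | (0 < l)%R]].

Definition A1 w := weight w /\ A1_constant w < +oo.

Definition weakly_porous E :=
  E !=set0 /\ exists2 a : R, (0 < a)%R & A1 (dist_pow E (- a)).

Definition Mu1 E : \bar R :=
  ereal_sup [set a%:E | a in [set a : R | (0 < a)%R /\ A1 (dist_pow E (- a))]].

End muckenhoupt.

Section C1.
Context {R : realType} {n : nat}.
Implicit Types (f : 'rV[R]_n -> R).

Definition gradient f (x : 'rV[R]_n) : 'rV[R]_n :=
  \row_(i < n) 'D_(delta_mx ord0 i) f x.

Definition vanishes_at_infinity f :=
  forall e : R, 0 < e ->
    exists M : R, forall x : 'rV[R]_n, M <= enorm x -> `|f x| < e.

Definition C10 f :=
  [/\ forall x, differentiable f x, continuous (gradient f) &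
      vanishes_at_infinity f].

End C1.

Definition Theta1 (R : realType) (n : nat) (p q : R) : R :=
  1 + n%:R * (q^-1 - p^-1).

Definition conj_exp (R : realType) (p : R) : R := p / (p - 1).

Definition far_set (R : realType) (n : nat) (E : set 'rV[R]_n) (kappa : R) :
    set 'rV[R]_n :=
  [set x | (kappa%:E * diam E <= (dist x E)%:E)%E].

(* Main.v *)
Require Import Defs.
From HB Require Import structures.
From mathcomp Require Import all_boot all_order all_algebra.
From mathcomp Require Import all_classical all_reals all_analysis.
From mathcomp Require Import measurable_realfun ess_sup_inf.
From mathcomp Require Import ring lra.

Set Implicit Arguments.
Unset Strict Implicit.
Unset Printing Implicit Defensive.

Import Order.TTheory GRing.Theory Num.Theory.
Import numFieldNormedType.Exports.

Local Open Scope classical_set_scope.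
Local Open Scope ring_scope.

(** Write d for the distance to E, r for the diameter of E, m = d + r,
    Th = 1 + n (1/q - 1/p), and s = beta p' / p = beta / (p - 1), so that
    d^-alpha is in A_1 for some alpha > s.  The condition q < n / Th amounts to
    p < n.

    A C^1 function vanishing at infinity is dominated by the Riesz potential of
    its gradient, |f(x)| <= C int |grad f(y)| |x - y|^(1 - n) dy
    ([riesz_representation]).  On the set where d >= kappa r one has
    m <= (2 / kappa) d, hence d^-Th <= (2 / kappa)^Th m^-Th, and this is the
    only place where kappa enters.  As E is a null set, it remains to show that
    the kernel
<<
      d(x)^(beta/p) m(x)^-Th d(y)^-(beta/p) |x - y|^(1 - n)
>>
    defines an operator bounded from L^p to L^q on the whole space
    ([bounded_riesz]), and to apply it to |grad f| d^(beta/p).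

    The A_1 condition is used through two estimates, valid for 0 <= t <= alpha:
    the integral of d^-t over a cube of centre x and side 2 rho is at most
    C rho^n d(x)^-t ([A1_power_integral]), and its integral over the set where
    m <= rho is at most C rho^(n - t) ([A1_power_growth]).

    Cut the kernel at |x - y| = m(x) / (2n).  On the near side m(x) and m(y)
    are comparable; on the far side |x - y| dominates max(m(x), m(y)) up to a
    constant and may be replaced by it.  Each part is written as a product
    K1 K2, and by Hoelder's inequality ([schur]) it is enough to bound the
    integral of K2^p' in y by some A(x)^p', and that of (A K1)^q in x by a
    constant.  All these integrals are integrals of powers against a measure of
    power growth, which are computed by cutting dyadically
    ([inner_power_integral], [tail_power_integral]).  They converge on the near
    side because Th > 0, and on the far side because 0 < s < alpha and
    q Th < n.  The powers of m(x) and m(y) that remain cancel by homogeneity. *)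

(** * Integration and measurability on R^n *)

(** The integral of a nonnegative function is a supremum over simple functions
    below it, so monotonicity holds without measurability. *)
Lemma le_integral_ge0 d (T : measurableType d) (R : realType)
    (mu : {measure set T -> \bar R}) (f g : T -> \bar R) :
  (forall x, 0 <= f x)%E -> (forall x, f x <= g x)%E ->
  (\int[mu]_x f x <= \int[mu]_x g x)%E.
Proof.
move=> f0 fg.
have g0 x : (0 <= g x)%E by exact: le_trans (f0 x) (fg x).
rewrite !ge0_integralTE//; apply: le_ereal_sup => _ [h hf <-].
by exists h => // x; exact: le_trans (hf x) (fg x).
Qed.

Section sup_norm.
Context {R : realType} {n : nat}.
Implicit Types x y : 'rV[R]_n.

Lemma sup_normP x (r : R) : 0 <= r ->
  (`|x| <= r) <-> (forall i, `|x ord0 i| <= r).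
Proof.
move=> r0; split=> [xr i|h].
  apply: le_trans xr; rewrite /Num.norm/= mx_normrE.
  exact: (le_bigmax_cond _ (fun i => `|x i.1 i.2|) (j := (ord0, i))).
rewrite /Num.norm/= mx_normrE; apply: bigmax_le => // -[j i] _ /=.
by rewrite ord1.
Qed.

Lemma sup_norm_coord x i : `|x ord0 i| <= `|x|.
Proof. by have /sup_normP := lexx `|x|; apply. Qed.

Lemma sup_normE_cube x y (r : R) : 0 <= r ->
  (`|y - x| <= r) <-> cube (x - const_mx r) (r *+ 2) y.
Proof.
move=> r0; rewrite sup_normP //; split => h i; have := h i; rewrite !mxE.
  by rewrite ler_norml; lra.
by rewrite ler_norml; lra.
Qed.

Lemma lebesgue_rV_cube x (r : R) : 0 <= r ->
  lebesgue_rV R n [set y : 'rV[R]_n | `|y - x| <= r] = ((r *+ 2) ^+ n)%:E.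
Proof.
move=> r0; rewrite [X in lebesgue_rV R n X](_ : _ = [set y : 'rV[R]_n | forall i,
    (x - const_mx r) ord0 i <= y ord0 i <= (x + const_mx r) ord0 i]).
  rewrite lebesgue_rV_box; last by move=> i; rewrite !mxE; lra.
  rewrite (eq_bigr (fun=> r *+ 2)); last by move=> i _; rewrite !mxE; lra.
  by rewrite prodr_const card_ord.
apply/seteqP; split => y /=.
  by move=> /(sup_normE_cube _ _ r0) h i; have := h i; rewrite !mxE; lra.
by move=> h; apply/(sup_normE_cube _ _ r0) => i; have := h i; rewrite !mxE; lra.
Qed.

(** The sigma-algebra is generated by the coordinates, and an open set is a
    countable union of open cubes with rational centre and radius 1 / (k + 1). *)
Lemma open_measurable_rV (U : set 'rV[R]_n) : open U -> measurable U.
Proof.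
move=> oU.
pose B (k : 'rV[rat]_n * nat) : set 'rV[R]_n :=
  [set y | forall i, `|ratr (k.1 ord0 i) - y ord0 i| < k.2.+1%:R^-1].
have mB k : measurable (B k).
  rewrite (_ : B k = \bigcap_(i in [set: 'I_n])
     ((fun v : 'rV[R]_n => v ord0 i) @^-1`
      [set z : R | `|ratr (k.1 ord0 i) - z| < k.2.+1%:R^-1])).
    apply: fin_bigcap_measurable => // i _.
    rewrite -[X in measurable X]setTI; apply: measurable_coord => //.
    exact: (@measurable_ball R (ratr (k.1 ord0 i)) k.2.+1%:R^-1).
  apply/seteqP; split => v /= h i; first by move=> _; exact: h.
  exact: h.
rewrite (_ : U = \bigcup_k (if asbool (B k `<=` U) then B k else set0)).
  apply: countable_bigcupT_measurable => //.
  by move=> k; case: ifPn => // _; exact: measurable0.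
apply/seteqP; split => [x Ux|x [k _]]; last first.
  by case: ifPn => // /asboolP; exact.
have [e /= e0 xeU] : exists2 e : R, 0 < e & ball x e `<=` U.
  by have /nbhs_ballP[e e0 ?] := (@open_nbhs_nbhs _ _ _ (conj oU Ux)); exists e.
have [m] : exists m : nat, m.+1%:R^-1 < e / 2.
  have h0 : 0 < e / 2 by rewrite divr_gt0.
  exists (Num.truncn (e / 2)^-1); rewrite -[ltRHS]invrK ltf_pV2 ?posrE ?invr_gt0//.
  exact: truncnS_gt.
move=> me.
have hq i : exists q : rat, `|ratr q - x ord0 i| < m.+1%:R^-1.
  have xx : x ord0 i - m.+1%:R^-1 < x ord0 i + m.+1%:R^-1 by rewrite ltrD2l gtrN ?invr_gt0.
  have [q] := rat_in_itvoo xx; rewrite in_itv/= => /andP[q1 q2]; exists q.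
  by rewrite ltr_norml ltrBlDl q2 andbT ltrBrDl; move: q1; rewrite addrC.
pose c : 'rV[rat]_n := \row_i sval (cid (hq i)).
have Bx : B (c, m) x by move=> i /=; rewrite mxE; case: cid.
exists (c, m) => //; case: ifPn => // /asboolP; case.
move=> y By; apply: xeU; split => // j i; rewrite ord1 /ball /=.
have h1 := Bx i; have h2 := By i; rewrite /= in h1 h2.
rewrite -[X in X < _](_ : `|(x ord0 i - ratr (c ord0 i)) + (ratr (c ord0 i) - y ord0 i)| = _); last by congr (`|_|); ring.
rewrite (le_lt_trans (ler_normD _ _))// distrC.
by rewrite [ltRHS](splitr e) ltrD// (lt_trans _ me).
Qed.

Lemma continuous_measurable_rV (f : 'rV[R]_n -> R) :
  continuous f -> measurable_fun [set: 'rV[R]_n] f.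
Proof.
move=> /continuousP cf.
apply: (measurability _ (RGenOpens.measurableE R)) => _ [_ [a [b ->] <-]].
rewrite setTI; apply: open_measurable_rV; apply: cf; exact: interval_open.
Qed.

End sup_norm.

(** * Dilations of Lebesgue measure *)

Section dilation.
Context {R : realType}.
Local Notation mu1 := (@lebesgue_measure R).
Local Open Scope ereal_scope.

Let affine (x t : R) : measurableTypeR R -> measurableTypeR R :=
  fun s => (x + t * s)%R.

Let measurable_affine x t : measurable_fun [set: _] (affine x t).
Proof. exact: measurable_funD. Qed.

(** Lebesgue measure is t times its image under s |-> x + t s, as both agree on
    half-open intervals. *)
Lemma integral_affine (F : R -> \bar R) (x t : R) : (0 < t)%R ->
  measurable_fun [set: R] F -> (forall s, 0 <= F s) ->
  \int[mu1]_s F s = t%:E * \int[mu1]_s F (x + t * s)%R.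
Proof.
move=> t0 mF F0.
have mt := measurable_affine x t.
pose nu' := mscale (NngNum (ltW t0)) (pushforward mu1 (affine x t))
  : {measure set (measurableTypeR R) -> \bar R}.
pose nu := nu' mt.
have muE A : measurable A -> mu1 A = nu A.
  apply: lebesgue_measure_unique => _ [[a b]] _ <-.
  rewrite /nu /nu' /= /mscale /pushforward /=.
  transitivity (t%:E * mu1 `]((a - x) / t)%R, ((b - x) / t)%R]); last first.
    congr (_ * mu1 _); apply/seteqP; split => s.
      rewrite /affine /= !in_itv/= ltr_pdivrMr// ler_pdivlMr//.
      by rewrite ltrBlDl lerBrDl (mulrC s).
    rewrite /affine /= !in_itv/= ltr_pdivrMr// ler_pdivlMr//.
    by rewrite ltrBlDl lerBrDl (mulrC s).
  rewrite !lebesgue_measure_itv/= !lte_fin ltr_pM2r ?invr_gt0// ltrD2r.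
  case: ifPn => _; last by rewrite mule0.
  rewrite -!EFinB -EFinM; congr EFin.
  by field; rewrite gt_eqF.
rewrite (@eq_measure_integral _ _ _ _ nu); last by move=> A mA _; exact: muE.
rewrite ge0_integral_mscale//=.
by rewrite ge0_integral_pushforward.
Qed.

Lemma lebesgue_rV_tonelli n (F : 'rV[R]_n.+1 -> \bar R) :
  measurable_fun [set: 'rV[R]_n.+1] F -> (forall v, 0 <= F v) ->
  \int[lebesgue_rV R n.+1]_v F v =
  \int[mu1]_s \int[lebesgue_rV R n]_w F (rV_cons (s, w)).
Proof.
move=> mF F0.
transitivity (\int[pushforward (mu1 \x lebesgue_rV R n) rV_cons]_v F v) => //.
rewrite ge0_integral_pushforward//; last exact: measurable_rV_cons.
rewrite preimage_setT fubini_tonelli1//; last by move=> z /=.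
by apply: measurableT_comp => //; exact: measurable_rV_cons.
Qed.

Lemma measurable_rV_affine n (x : 'rV[R]_n) (t : R) :
  measurable_fun [set: 'rV[R]_n] (fun z : 'rV[R]_n => (x + t *: z)%R).
Proof.
apply: measurable_fun_rV => i.
rewrite (_ : (fun _ => _) = (fun z : 'rV[R]_n => (x ord0 i + t * z ord0 i)%R)).
  apply: measurable_funD => //; apply: measurable_funM => //.
  exact: measurable_coord.
by apply/funext => z; rewrite !mxE.
Qed.

(** By induction on the dimension, one coordinate at a time. *)
Lemma integral_dilation n (F : 'rV[R]_n -> \bar R) (x : 'rV[R]_n) (t : R) :
  (0 < t)%R -> measurable_fun [set: 'rV[R]_n] F -> (forall v, 0 <= F v) ->
  \int[lebesgue_rV R n]_v F v =
  (t ^+ n)%:E * \int[lebesgue_rV R n]_z F (x + t *: z)%R.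
Proof.
move=> t0; elim: n F x => [|n IH] F x mF F0.
  rewrite expr0 mul1e /=; apply: eq_integral => z _; congr F.
  by apply/rowP => -[].
have mcons : measurable_fun [set: _] (fun p : measurableTypeR R * 'rV[R]_n => F (rV_cons p)).
  by apply: measurableT_comp => //; exact: measurable_rV_cons.
have F10 s : 0 <= \int[lebesgue_rV R n]_w F (rV_cons (s, w)).
  exact: integral_ge0.
have mF1 : measurable_fun [set: measurableTypeR R]
    (fun s => \int[lebesgue_rV R n]_w F (rV_cons (s, w))).
  by apply: (measurable_fun_fubini_tonelli_F (fun p => F (rV_cons p))) => // p.
rewrite [LHS]lebesgue_rV_tonelli// (integral_affine (x ord0 ord0) t0)//.
rewrite lebesgue_rV_tonelli//; last first.
  by apply: measurableT_comp => //; exact: measurable_rV_affine.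
rewrite exprS EFinM -muleA; congr (_ * _).
rewrite -ge0_integralZl//; last 3 first.
- apply: (measurable_fun_fubini_tonelli_F (fun p => F (x + t *: rV_cons p)%R)) => //.
  apply: (measurableT_comp (f := F)) => //.
  apply: (measurableT_comp (measurable_rV_affine x t)); exact: measurable_rV_cons.
- by move=> s _; exact: integral_ge0.
- by rewrite lee_fin exprn_ge0 ?ltW.
apply: eq_integral => s _.
rewrite (IH (fun w => F (rV_cons ((x ord0 ord0 + t * s)%R, w))) (rV_behead x))//; last first.
  apply: (measurableT_comp (f := fun p : measurableTypeR R * 'rV[R]_n => F (rV_cons p))) => //.
congr (_ * _); apply: eq_integral => w _; congr F.
apply/rowP => i; rewrite [RHS]mxE [in RHS]mxE.
have [j ->|->] := unliftP ord0 i.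
  by rewrite !rV_consS/= !mxE.
by rewrite !rV_cons0.
Qed.

End dilation.

(** * The Euclidean norm and the distance to a set *)

Section enorm_theory.
Context {R : realType} {n : nat}.
Implicit Types (x y v : 'rV[R]_n) (E : set 'rV[R]_n).

Lemma enorm_ge0 v : 0 <= enorm v.
Proof. exact: sqrtr_ge0. Qed.

Lemma enorm_sqr v : enorm v ^+ 2 = \sum_(i < n) v ord0 i ^+ 2.
Proof. by rewrite sqr_sqrtr// sumr_ge0// => i _; exact: sqr_ge0. Qed.

Lemma coord_le_enorm v i : `|v ord0 i| <= enorm v.
Proof.
rewrite -sqrtr_sqr ler_wsqrtr// (bigD1 i)//= lerDl sumr_ge0// => j _.
exact: sqr_ge0.
Qed.

Lemma sup_norm_le_enorm v : `|v| <= enorm v.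
Proof. by apply/sup_normP; [exact: enorm_ge0|exact: coord_le_enorm]. Qed.

Lemma enorm_le_sup_norm v : enorm v <= n%:R * `|v|.
Proof.
rewrite -[leRHS]ger0_norm ?mulr_ge0// -sqrtr_sqr ler_wsqrtr//.
apply: (@le_trans _ _ (\sum_(i < n) `|v| ^+ 2)).
  by apply: ler_sum => i _; rewrite -real_normK ?num_real// lerXn2r ?nnegrE ?sup_norm_coord.
rewrite sumr_const card_ord exprMn -[leLHS]mulr_natl ler_wpM2r ?sqr_ge0//.
by rewrite -natrX ler_nat; case: n => // k; rewrite leq_pmull.
Qed.

(** If a > 0 and b > 0 are the norms of x and y, then 2 u v <= (b / a) u^2 + (a / b) v^2 in each
    coordinate; the sum over the coordinates is 2 a b on the right. *)
Lemma ler_enormD x y : enorm (x + y) <= enorm x + enorm y.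
Proof.
have [a0|a0] := eqVneq (enorm x) 0.
  have -> : x = 0.
    apply/rowP => i; rewrite mxE; apply/eqP; rewrite -normr_le0 -a0.
    exact: coord_le_enorm.
  by rewrite add0r lerDr enorm_ge0.
have [b0|b0] := eqVneq (enorm y) 0.
  have -> : y = 0.
    apply/rowP => i; rewrite mxE; apply/eqP; rewrite -normr_le0 -b0.
    exact: coord_le_enorm.
  by rewrite addr0 lerDl enorm_ge0.
set a := enorm x in a0 *; set b := enorm y in b0 *.
have {a0}a0 : 0 < a by rewrite lt_neqAle eq_sym a0 enorm_ge0.
have {b0}b0 : 0 < b by rewrite lt_neqAle eq_sym b0 enorm_ge0.
rewrite -ler_sqr ?nnegrE ?enorm_ge0 ?addr_ge0 ?(ltW a0) ?(ltW b0)//.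
rewrite enorm_sqr.
apply: (@le_trans _ _ (\sum_(i < n) ((1 + b / a) * x ord0 i ^+ 2 + (1 + a / b) * y ord0 i ^+ 2))).
  apply: ler_sum => i _; rewrite mxE -subr_ge0.
  set u := x ord0 i; set w := y ord0 i.
  rewrite (_ : _ - _ = (b * u - a * w) ^+ 2 / (a * b)); last first.
    by field; rewrite !gt_eqF.
  by rewrite divr_ge0 ?sqr_ge0// mulr_ge0 ?ltW.
rewrite big_split/= -!mulr_sumr -!enorm_sqr -/a -/b.
rewrite [leLHS](_ : _ = (a + b) ^+ 2)//.
by field; rewrite !gt_eqF.
Qed.

Lemma measurable_enorm : measurable_fun [set: 'rV[R]_n] (@enorm R n).
Proof.
apply: (measurableT_comp (f := @Num.sqrt R)).
  by apply: continuous_measurable_fun; exact: sqrt_continuous.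
apply: measurable_sum => i; apply: measurable_funX; exact: measurable_coord.
Qed.

Lemma dist_ge0 x E : 0 <= dist x E.
Proof.
have [->|/set0P E0] := eqVneq E set0; first by rewrite /dist image_set0 inf0.
apply: lb_le_inf; first by case: E0 => y Ey; exists (enorm (x - y)), y.
by move=> _ [y _ <-]; exact: enorm_ge0.
Qed.

Lemma dist_le_enorm x E y : E y -> dist x E <= enorm (x - y).
Proof.
move=> Ey; apply: ge_inf; last by exists y.
by exists 0 => _ [z _ <-]; exact: enorm_ge0.
Qed.

Lemma le_dist x E (r : R) : E !=set0 ->
  (forall y, E y -> r <= enorm (x - y)) -> r <= dist x E.
Proof.
move=> [y Ey] h; apply: lb_le_inf; first by exists (enorm (x - y)), y.
by move=> _ [z Ez <-]; exact: h.
Qed.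

Lemma dist_lipschitz x y E : E !=set0 ->
  dist x E <= dist y E + n%:R * `|x - y|.
Proof.
move=> E0; rewrite -lerBlDr; apply: le_dist => // z Ez.
rewrite lerBlDr (le_trans (dist_le_enorm _ Ez))//.
rewrite (_ : x - z = (y - z) + (x - y)); last by rewrite [RHS]addrC addrA subrK.
by rewrite (le_trans (ler_enormD _ _))// lerD2l enorm_le_sup_norm.
Qed.

Lemma continuous_dist E : E !=set0 -> continuous (dist ^~ E).
Proof.
move=> E0 x.
apply/(@cvgrPdist_le R R _ (nbhs x) (nbhs_filter x)) => /= e e0.
have n0 : 0 < n%:R + 1 :> R by rewrite ltr_wpDl.
apply/nbhs_ballP; exists (e / (n%:R + 1)); first by rewrite /= divr_gt0.
move=> y /=; rewrite mx_norm_ball /ball_ /= => /ltW xy.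
have h : n%:R * `|x - y| <= e.
  rewrite (le_trans (ler_wpM2l _ xy))// mulrA ler_pdivrMr// mulrC ler_pM2l//.
  by rewrite lerDl.
have := dist_lipschitz x y E0; have := dist_lipschitz y x E0.
rewrite (distrC y x) => h1 h2; rewrite ler_norml; lra.
Qed.

Lemma measurable_dist E : E !=set0 ->
  measurable_fun [set: 'rV[R]_n] (dist ^~ E).
Proof. by move=> /continuous_dist; exact: continuous_measurable_rV. Qed.

End enorm_theory.

(** * The Riesz potential of the gradient *)

Section ray.
Context {R : realType} {n : nat}.
Variables (f : 'rV[R]_n -> R).
Hypothesis df : forall x, differentiable f x.
Hypothesis cf : continuous (gradient f).
Implicit Types x z : 'rV[R]_n.

Lemma derive_gradient x z :
  'D_z f x = \sum_(i < n) z ord0 i * gradient f x ord0 i.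
Proof.
rewrite deriveE// [in LHS](row_sum_delta z) linear_sum; apply: eq_bigr => i _.
by rewrite linearZ mxE deriveE.
Qed.

Lemma derive_le_enorm_gradient x z :
  `|'D_z f x| <= n%:R * `|z| * enorm (gradient f x).
Proof.
rewrite derive_gradient (le_trans (ler_norm_sum _ _ _))//.
apply: (@le_trans _ _ (\sum_(i < n) `|z| * enorm (gradient f x))).
  apply: ler_sum => i _; rewrite normrM ler_pM//; first exact: sup_norm_coord.
  exact: coord_le_enorm.
by rewrite sumr_const card_ord -[leLHS]mulr_natl mulrA.
Qed.

Lemma continuous_ray x z : continuous (fun t : R => x + t *: z).
Proof.
move=> t; apply: (@cvgD R 'rV[R]_n R (nbhs t) (nbhs_filter t)).
  exact: cvg_cst.
exact: cvgZr_tmp.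
Qed.

Lemma continuous_gradient_coord i : continuous (fun x => gradient f x ord0 i).
Proof.
move=> x; apply: (@continuous_comp _ _ _ (gradient f) (fun v : 'rV[R]_n => v ord0 i)).
  exact: cf.
exact: coord_continuous.
Qed.

Lemma continuous_derive_ray x z :
  continuous (fun t : R => 'D_z f (x + t *: z)).
Proof.
rewrite (_ : (fun _ => _) = (fun t : R => \sum_(i < n)
   z ord0 i * gradient f (x + t *: z) ord0 i)); last first.
  by apply/funext => t; rewrite derive_gradient.
move=> t; apply: cvg_big => [|i _]; first exact: add_continuous.
apply: cvgM; first exact: cvg_cst.
apply: (@continuous_comp _ _ _ (fun t : R => x + t *: z)
  (fun x => gradient f x ord0 i)); first exact: continuous_ray.
exact: continuous_gradient_coord.
Qed.

Lemma is_derive_ray x z (t : R) :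
  is_derive t 1 (fun t : R => f (x + t *: z)) ('D_z f (x + t *: z)).
Proof.
have E : (fun h : R => h^-1 *: ((f \o shift (x + t *: z)) (h *: z) - f (x + t *: z)))
       = (fun h : R => h^-1 *: (((fun t : R => f (x + t *: z)) \o shift t) (h *: 1) - f (x + t *: z))).
  apply/funext => h /=; congr (_ *: (f _ - _)).
  by rewrite scalerDl addrCA [h *: 1]mulr1.
have dfz : derivable f (x + t *: z) z by exact: diff_derivable.
by split; rewrite /derivable /derive -E.
Qed.

Lemma ftc_ray x z (T : R) : 0 < T ->
  (`|f x|%:E <= `|f (x + T *: z)|%:E +
    \int[@lebesgue_measure R]_(t in `[0%R, T]) `|'D_z f (x + t *: z)|%:E)%E.
Proof.
move=> T0.
have FTC := @continuous_FTC2 R (fun t => 'D_z f (x + t *: z))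
  (fun t => f (x + t *: z)) 0 T T0.
have cD := @continuous_derive_ray x z.
have mD : measurable_fun `[0%R, T] (fun t => 'D_z f (x + t *: z)).
  by apply: measurable_funTS; exact: continuous_measurable_fun.
have cF : continuous (fun t : R => f (x + t *: z)).
  move=> t; apply: differentiable_continuous; apply/derivable1_diffP.
  by have [] := is_derive_ray x z t.
have E : (\int[@lebesgue_measure R]_(t in `[0%R, T]) ('D_z f (x + t *: z))%:E =
          (f (x + T *: z))%:E - (f x)%:E)%E.
  rewrite FTC ?scale0r ?addr0//.
  - exact: continuous_subspaceT.
  - split.
    + by move=> t _; have [] := is_derive_ray x z t.
    + exact/cvg_at_right_filter/cF.
    + exact/cvg_at_left_filter/cF.
  - by move=> t _; rewrite derive1E; have [] := is_derive_ray x z t.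
have := @le_abse_integral _ _ _ (@lebesgue_measure R) `[0%R, T]%classic
  (fun t => ('D_z f (x + t *: z))%:E).
rewrite E => /(_ _ _)/= h.
have {}h := h (measurable_itv _) (measurableT_comp (@EFin_measurable _ _) mD).
apply: le_trans (leeD (lexx _) h).
rewrite -EFinD lee_fin.
have := ler_distD (f (x + T *: z)) 0 (f x); rewrite !sub0r !normrN.
by [].
Qed.

End ray.

Lemma measurable_indic_comp d d' (T : measurableType d) (U : measurableType d')
    (R : realType) (g : T -> U) (A : set U) : measurable A ->
  measurable_fun [set: T] g ->
  measurable_fun [set: T] (fun x => \1_A (g x) : R).
Proof. by move=> mA mg; apply: (measurableT_comp (f := \1_A : U -> R)). Qed.

Lemma measurable_normB d (T : measurableType d) (R : realType) n
    (g h : T -> 'rV[R]_n) :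
  measurable_fun [set: T] g -> measurable_fun [set: T] h ->
  measurable_fun [set: T] (fun t => `|g t - h t|).
Proof.
move=> mg mh; apply: (measurableT_comp (f := fun v : 'rV[R]_n => `|v|)).
  by apply: continuous_measurable_rV; exact: norm_continuous.
apply: measurable_fun_rV => i; rewrite (_ : (fun _ => _) =
    (fun t => g t ord0 i - h t ord0 i)); last by apply/funext => t; rewrite !mxE.
by apply: measurable_funB; apply: (measurableT_comp (measurable_coord i)).
Qed.

Section riesz.
Context {R : realType} {n : nat}.
Hypothesis n0 : (0 < n)%N.
Variables (f : 'rV[R]_n -> R).
Hypothesis C10f : C10 f.
Implicit Types x y z : 'rV[R]_n.
Local Notation mu1 := (@lebesgue_measure R).
Local Notation mu := (lebesgue_rV R n).

(** The directions of the rays: a cube of measure 1 that avoids the origin. *)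
Let S : set 'rV[R]_n := cube (const_mx 1) 1.

Let S_norm z : S z -> 1 <= `|z| <= 2.
Proof.
move=> Sz; apply/andP; split.
  apply: le_trans (sup_norm_coord z (Ordinal n0)).
  by have := Sz (Ordinal n0); rewrite mxE => /andP[h _]; rewrite ler_normr h.
apply/sup_normP => // i; have := Sz i; rewrite mxE ler_norml; lra.
Qed.

Lemma measurable_enorm_gradient :
  measurable_fun [set: 'rV[R]_n] (fun y => enorm (gradient f y)).
Proof.
case: C10f => df cf _.
apply: (measurableT_comp measurable_enorm); apply: measurable_fun_rV => i.
by apply: continuous_measurable_rV; exact: continuous_gradient_coord.
Qed.

Let H y : R := 2 * n%:R * enorm (gradient f y).

Let H0 y : 0 <= H y.
Proof. by rewrite !mulr_ge0// enorm_ge0. Qed.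

Let mH : measurable_fun [set: 'rV[R]_n] H.
Proof. by apply: measurable_funM => //; exact: measurable_enorm_gradient. Qed.

(** The gradient at the points x + t z, in the variables (t, z). *)
Let Phi x (p : measurableTypeR R * 'rV[R]_n) : R :=
  \1_(`]0, +oo[%classic : set R) p.1 * (\1_S p.2 * H (x + p.1 *: p.2)).

Let Phi0 x p : 0 <= Phi x p.
Proof. by rewrite /Phi !indicE mulr_ge0// mulr_ge0. Qed.

(** The derivative along z is at most n |z| |grad f|, with |z| <= 2, and f tends
    to 0 along the ray. *)
Lemma ray_bound x z : S z ->
  (`|f x|%:E <= \int[mu1]_t (Phi x (t, z))%:E)%E.
Proof.
move=> Sz; have /andP[z1 z2] := S_norm Sz.
case: C10f => df cf f0; apply/lee_addgt0Pr => e e0.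
have [M hM] := f0 _ e0.
(* far enough for x + T z to lie outside the ball of radius M, as |z| >= 1 *)
pose T : R := `|x| + `|M| + 1.
have T0 : 0 < T by rewrite /T -addrA ltr_wpDl// ltr_wpDl.
apply: (le_trans (ftc_ray df cf x z T0)).
rewrite addeC leeD//; last first.
  rewrite lee_fin ltW//; apply: hM.
  apply: le_trans (sup_norm_le_enorm _).
  have h1 : T <= `|T *: z| by rewrite normrZ (gtr0_norm T0) ler_peMr// ltW.
  have h2 : `|T *: z| <= `|x + T *: z| + `|x|.
    by rewrite -{1}(addKr x (T *: z)) addrC (le_trans (ler_normB _ _)).
  have h3 := ler_norm M; rewrite /T in h1 h2 *; lra.
rewrite -integral_itv_obnd_cbnd.
  rewrite integral_mkcond; apply: le_integral_ge0 => t.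
    by rewrite patchE; case: ifPn => // _; rewrite lee_fin.
  rewrite patchE; case: ifPn => [|_]; last first.
    by rewrite lee_fin Phi0.
  rewrite inE/= in_itv/= => /andP[t0 tT].
  rewrite lee_fin /Phi/= !indicE !mem_set//=; last by rewrite in_itv/= t0.
  rewrite !mul1r (le_trans (derive_le_enorm_gradient df _ _))//.
  by rewrite /H ler_wpM2r ?enorm_ge0// mulrC ler_wpM2r.
apply: measurable_funTS; apply/measurable_EFinP; apply: measurableT_comp => //.
by apply: continuous_measurable_fun; exact: continuous_derive_ray.
Qed.

Let mS : measurable S. Proof. exact: measurable_cube. Qed.

Let measurable_line x :
  measurable_fun [set: measurableTypeR R * 'rV[R]_n] (fun p => x + p.1 *: p.2).
Proof.
apply: measurable_fun_rV => i.
rewrite (_ : (fun _ => _) = (fun p : measurableTypeR R * 'rV[R]_n =>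
   (x ord0 i + p.1 * p.2 ord0 i)%R)); last by apply/funext => p; rewrite !mxE.
apply: measurable_funD => //; apply: measurable_funM => //.
exact: (measurableT_comp (measurable_coord i) measurable_snd).
Qed.

Let mPhi x : measurable_fun [set: _] (Phi x).
Proof.
apply: measurable_funM.
  exact: (measurable_indic_comp (measurable_itv _) measurable_fst).
apply: measurable_funM.
  exact: (measurable_indic_comp mS measurable_snd).
exact: measurableT_comp.
Qed.

(** What Phi becomes in the variables (t, y) with y = x + t z. *)
Let Psi x (p : measurableTypeR R * 'rV[R]_n) : R :=
  \1_(`]0, +oo[%classic : set R) p.1 * ((p.1 `^ (-1)) ^+ n *
  (\1_S (p.1 `^ (-1) *: (p.2 - x)) * H p.2)).

Let Psi0 x p : 0 <= Psi x p.
Proof.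
by rewrite /Psi !indicE mulr_ge0// mulr_ge0 ?exprn_ge0 ?powR_ge0// mulr_ge0.
Qed.

Let mPsi x : measurable_fun [set: _] (Psi x).
Proof.
have mp : measurable_fun [set: measurableTypeR R * 'rV[R]_n] (fun p => p.1 `^ (-1)).
  exact: (measurableT_comp (measurable_powR _) measurable_fst).
apply: measurable_funM.
  exact: (measurable_indic_comp (measurable_itv _) measurable_fst).
apply: measurable_funM; first exact: measurable_funX.
apply: measurable_funM; last exact: (measurableT_comp mH measurable_snd).
apply: measurable_indic_comp => //.
apply: measurable_fun_rV => i.
rewrite (_ : (fun _ => _) = (fun p : measurableTypeR R * 'rV[R]_n =>
   (p.1 `^ (-1) * (p.2 ord0 i - x ord0 i))%R)); last first.
  by apply/funext => p; rewrite !mxE.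
apply: measurable_funM => //; apply: measurable_funB => //.
exact: (measurableT_comp (measurable_coord i) measurable_snd).
Qed.

Let Phi_Psi x t :
  (\int[mu]_z (Phi x (t, z))%:E = \int[mu]_y (Psi x (t, y))%:E)%E.
Proof.
have [t0|t0] := boolP (t \in (`]0, +oo[%classic : set R)); last first.
  by apply: eq_integral => z _; rewrite /Phi /Psi /= !indicE (negbTE t0) !mul0r.
have {}t0 : 0 < t by move: t0; rewrite inE/= in_itv/= andbT.
have mPsit : measurable_fun [set: 'rV[R]_n] (fun y => (Psi x (t, y))%:E).
  by apply/measurable_EFinP; apply: (measurableT_comp (mPsi x)); exact: measurable_pair1.
rewrite [RHS](integral_dilation x t0)//; last by move=> z; rewrite lee_fin.
rewrite -ge0_integralZl//; last 3 first.
- by apply: (measurableT_comp mPsit); exact: measurable_rV_affine.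
- by move=> z _; rewrite lee_fin.
- by rewrite lee_fin exprn_ge0 ?ltW.
apply: eq_integral => z _; rewrite -EFinM; congr EFin.
rewrite /Phi /Psi /= powR_inv1 ?(ltW t0)// [x + _]addrC addrK scalerA.
rewrite mulVf ?gt_eqF// scale1r [t *: z + x]addrC.
rewrite [RHS]mulrCA; congr (_ * _).
by rewrite [RHS]mulrA -exprMn divff ?gt_eqF// expr1n mul1r.
Qed.

(** For fixed y only the t between |y - x| / 2 and |y - x| contribute: an
    interval of length |y - x| / 2 on which t^-n <= (|y - x| / 2)^-n. *)
Let Psi_le x y :
  (\int[mu1]_t (Psi x (t, y))%:E <=
    (n%:R * 2 ^+ n * (enorm (gradient f y) * `|y - x| `^ (1 - n%:R)))%:E)%E.
Proof.
set r := `|y - x|; set b := n%:R * 2 ^+ n * _.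
have [r0|r0] := eqVneq r 0.
  rewrite (eq_integral (cst 0%E)); last first.
    move=> t _; congr EFin; rewrite /Psi /= !indicE.
    rewrite [_ \in S](_ : _ = false) ?mul0r ?mulr0//.
    apply/negP; rewrite inE => /S_norm; rewrite normrZ -/r r0 mulr0; lra.
  by rewrite integral0 lee_fin !mulr_ge0// ?enorm_ge0 ?powR_ge0.
have {}r0 : 0 < r by rewrite lt_neqAle eq_sym r0 /r /=.
apply: (@le_trans _ _ (\int[mu1]_t (((r / 2) ^- n * H y)%:E * (\1_(`[r / 2, r]%classic : set R) t)%:E))%E).
  apply: le_integral_ge0 => t; first by rewrite lee_fin.
  rewrite -EFinM lee_fin /Psi/=.
  rewrite [X in X * _]indicE; have [t0|_] := boolP (t \in (`]0, +oo[%classic : set R)); last first.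
    by rewrite mul0r mulr_ge0 ?indicE// mulr_ge0// invr_ge0 exprn_ge0// divr_ge0// ltW.
  have {}t0 : 0 < t by move: t0; rewrite inE/= in_itv/= andbT.
  rewrite mul1r [X in _ * (X * _)]indicE; have [St|_] := boolP (_ \in S); last first.
    by rewrite mul0r mulr0 mulr_ge0 ?indicE// mulr_ge0// invr_ge0 exprn_ge0// divr_ge0// ltW.
  move: St; rewrite inE => /S_norm; rewrite normrZ -/r ger0_norm ?powR_ge0//.
  rewrite powR_inv1 ?(ltW t0)// ler_pdivlMl// mulr1 ler_pdivrMl// => /andP[tr rt].
  rewrite indicE mem_set/=; last by rewrite in_itv/= tr andbT ler_pdivrMr.
  rewrite mulr1 mul1r ler_wpM2r// exprVn lef_pV2 ?posrE ?exprn_gt0 ?divr_gt0//.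
  by rewrite lerXn2r ?nnegrE ?divr_ge0 ?(ltW r0) ?(ltW t0)// ler_pdivrMr.
rewrite ge0_integralZl//; last 2 first.
- by apply/measurable_EFinP; exact: measurable_indic.
- by rewrite lee_fin mulr_ge0// invr_ge0 exprn_ge0// divr_ge0// ltW.
rewrite integral_indic// setIT.
rewrite [X in (_ * X)%E](_ : _ = lebesgue_measure (`[r / 2, r]%classic : set R))//.
rewrite lebesgue_measure_itv/= lte_fin ltr_pdivrMr//.
rewrite ltr_pMr// ltr1n -EFinB -EFinM lee_fin /b /H.
rewrite powRD ?(gt_eqF r0) ?implybT// powRr1 ?(ltW r0)// powRN powR_mulrn ?(ltW r0)//.
rewrite exprMn exprVn invfM invrK le_eqVlt; apply/orP; left; apply/eqP.
by field; rewrite expf_neq0 ?gt_eqF.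
Qed.

(** Average [ray_bound] over the directions, exchange the integrals, and
    substitute y = x + t z for each t, which produces the factor t^-n. *)
Lemma riesz_representation x :
  (`|f x|%:E <= (n%:R * 2 ^+ n)%:E *
    \int[mu]_y (enorm (gradient f y) * `|y - x| `^ (1 - n%:R))%:E)%E.
Proof.
have muS : mu S = 1%E.
  rewrite (_ : S = [set v : 'rV[R]_n | forall i, (const_mx 1 : 'rV[R]_n) ord0 i <= v ord0 i <= (const_mx 2 : 'rV[R]_n) ord0 i]).
    rewrite lebesgue_rV_box; last by move=> i; rewrite !mxE ler1n.
    by rewrite big1// => i _; rewrite !mxE; lra.
  by apply/seteqP; split => v /= h i; have := h i; rewrite !mxE; lra.
apply: (@le_trans _ _ (\int[mu]_z \int[mu1]_t (Phi x (t, z))%:E)%E).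
  rewrite -[leLHS]mule1 -muS -[S]setIT -integral_indic//.
  rewrite -ge0_integralZl//.
  - apply: le_integral_ge0 => z; first by rewrite mule_ge0 ?lee_fin ?indicE.
    rewrite indicE; have [Sz|_] := boolP (z \in S); last first.
      by rewrite mule0; apply: integral_ge0 => t _; rewrite lee_fin.
    by rewrite mule1; apply: ray_bound; move: Sz; rewrite inE.
  - by apply: measurableT_comp => //; exact: measurable_indic.
have F1 := @fubini_tonelli _ _ _ _ R mu1 mu (fun p => (Phi x p)%:E)
  (measurableT_comp (@EFin_measurable _ _) (mPhi x)) (fun p => Phi0 x p).
have F2 := @fubini_tonelli _ _ _ _ R mu1 mu (fun p => (Psi x p)%:E)
  (measurableT_comp (@EFin_measurable _ _) (mPsi x)) (fun p => Psi0 x p).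
rewrite -[leLHS]F1; under eq_integral do rewrite Phi_Psi.
rewrite [leLHS]F2 {F1 F2}.
rewrite -ge0_integralZl//; last 2 first.
- apply/measurable_EFinP; apply: measurable_funM.
    exact: measurable_enorm_gradient.
  apply: (measurableT_comp (measurable_powR _)).
  by apply: measurable_normB => //; exact: measurable_cst.
- by move=> y _; rewrite lee_fin mulr_ge0 ?enorm_ge0 ?powR_ge0.
apply: le_integral_ge0 => y.
  by apply: integral_ge0 => t _; rewrite lee_fin.
by rewrite -EFinM; exact: Psi_le.
Qed.

End riesz.

(** * Integral operators from L^p to L^q *)

Lemma ge0_hoelder d (T : measurableType d) (R : realType)
    (mu : {measure set T -> \bar R}) (u v : T -> R) (p q : R) :
  measurable_fun [set: T] u -> measurable_fun [set: T] v ->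
  (forall x, 0 <= u x) -> (forall x, 0 <= v x) ->
  0 < p -> 0 < q -> p^-1 + q^-1 = 1 ->
  (\int[mu]_x (u x * v x)%:E <=
   (\int[mu]_x (u x `^ p)%:E) `^ p^-1 * (\int[mu]_x (v x `^ q)%:E) `^ q^-1)%E.
Proof.
move=> mu_ mv u0 v0 p0 q0 pq; have := hoelder mu mu_ mv p0 q0 pq.
rewrite Lnorm1 unlock /=.
under eq_integral do rewrite ger0_norm ?mulr_ge0//.
under [X in (_ <= X `^ _ * _)%E -> _]eq_integral do rewrite ger0_norm//.
by under [X in (_ <= _ * X `^ _)%E -> _]eq_integral do rewrite ger0_norm//.
Qed.

(** A test for boundedness from L^p to L^q of a kernel K1 K2, in the style of
    Schur: K2 is integrated out in y by Hoelder's inequality, at the price of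
    A(x), and K1, weighted by A, is integrated in x. *)
Section schur.
Context d1 d2 (T1 : measurableType d1) (T2 : measurableType d2) (R : realType).
Variables (m1 : {sigma_finite_measure set T1 -> \bar R}).
Variables (m2 : {sigma_finite_measure set T2 -> \bar R}).
Variables (K1 K2 : T1 * T2 -> R) (A : T1 -> R) (p p' q B : R).
Hypothesis p1 : 0 < p.
Hypothesis p'1 : 0 < p'.
Hypothesis pp' : p^-1 + p'^-1 = 1.
Hypothesis pq : p <= q.
Hypothesis mK1 : measurable_fun [set: T1 * T2] K1.
Hypothesis mK2 : measurable_fun [set: T1 * T2] K2.
Hypothesis mA : measurable_fun [set: T1] A.
Hypothesis K10 : forall z, 0 <= K1 z.
Hypothesis K20 : forall z, 0 <= K2 z.
Hypothesis A0 : forall x, 0 <= A x.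
Hypothesis B0 : 0 < B.
Hypothesis HK2 : forall x, (\int[m2]_y (K2 (x, y) `^ p')%:E <= (A x `^ p')%:E)%E.
Hypothesis HK1 : forall y, (\int[m1]_x ((A x * K1 (x, y)) `^ q)%:E <= B%:E)%E.
Variable g : T2 -> R.
Hypothesis mg : measurable_fun [set: T2] g.
Hypothesis g0 : forall y, 0 <= g y.

Let G := (\int[m2]_y (g y `^ p)%:E)%E.

Let G0 : (0 <= G)%E.
Proof. by apply: integral_ge0 => y _; rewrite lee_fin powR_ge0. Qed.

Let mK1x x : measurable_fun [set: T2] (fun y => K1 (x, y)).
Proof. exact: measurableT_comp. Qed.

Let mK2x x : measurable_fun [set: T2] (fun y => K2 (x, y)).
Proof. exact: measurableT_comp. Qed.

Let q0 : 0 < q. Proof. exact: lt_le_trans p1 pq. Qed.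

Let schur_step1 x : (\int[m2]_y (K1 (x, y) * K2 (x, y) * g y)%:E <=
  (A x)%:E * (\int[m2]_y ((K1 (x, y) * g y) `^ p)%:E) `^ p^-1)%E.
Proof.
under eq_integral do rewrite mulrAC.
apply: (le_trans (@ge0_hoelder _ _ _ m2 (fun y => K1 (x, y) * g y)
  (fun y => K2 (x, y)) _ _ _ _ _ _ p1 p'1 pp')) => //.
- exact: measurable_funM.
- by move=> y; rewrite mulr_ge0.
rewrite muleC lee_wpmul2r ?poweR_ge0//.
rewrite -[leRHS]poweRe1 ?lee_fin// -(@divff _ p') ?gt_eqF// poweRrM.
apply: gt0_ler_poweR; rewrite ?invr_ge0 ?(ltW p'1)//.
- by rewrite in_itv/= leey andbT; apply: integral_ge0 => y _; rewrite lee_fin powR_ge0.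
- by rewrite in_itv/= leey andbT lee_fin powR_ge0.
Qed.

(** For p < q, Hoelder's inequality with exponent q / p for the measure g^p dy
    raises the exponent of K1 from p to q. *)
Let schur_step2 x : (G < +oo)%E ->
  ((\int[m2]_y ((K1 (x, y) * g y) `^ p)%:E) `^ (q / p) <=
   G `^ (q / p - 1) * \int[m2]_y (K1 (x, y) `^ q * g y `^ p)%:E)%E.
Proof.
move=> Goo; have [qp|qp] := eqVneq p q.
  rewrite -qp divff ?gt_eqF// subrr poweRe0 mul1e poweRe1; last first.
    by apply: integral_ge0 => y _; rewrite lee_fin powR_ge0.
  by under eq_integral do rewrite powRM//.
have {}qp : p < q by rewrite lt_neqAle qp pq.
pose r := q / p; pose r' := r / (r - 1).
have r1 : 1 < r by rewrite ltr_pdivlMr// mul1r.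
have r0 : 0 < r by rewrite (lt_trans _ r1).
have r'0 : 0 < r' by rewrite divr_gt0// subr_gt0.
have rr' : r^-1 + r'^-1 = 1.
  by rewrite /r'; field; rewrite !gt_eqF// subr_gt0.
have E y : (K1 (x, y) * g y) `^ p =
    (K1 (x, y) `^ p * g y `^ (p / r)) * g y `^ (p / r').
  rewrite -mulrA -powRD; last by rewrite -mulrDr rr' mulr1 gt_eqF.
  by rewrite -mulrDr rr' mulr1 powRM.
under eq_integral do rewrite E.
have E1 y : (K1 (x, y) `^ p * g y `^ (p / r)) `^ r = K1 (x, y) `^ q * g y `^ p.
  rewrite powRM ?powR_ge0// -!powRrM divfK ?gt_eqF//.
  by congr (_ `^ _ * _); rewrite /r; field; rewrite gt_eqF.
have E2 y : (g y `^ (p / r')) `^ r' = g y `^ p.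
  by rewrite -powRrM divfK ?gt_eqF.
have mgp a : measurable_fun [set: T2] (fun y => g y `^ a).
  exact: (measurableT_comp (measurable_powR _)).
have mu : measurable_fun [set: T2] (fun y => K1 (x, y) `^ p * g y `^ (p / r)).
  by apply: measurable_funM => //; exact: (measurableT_comp (measurable_powR _)).
have u0 y : 0 <= K1 (x, y) `^ p * g y `^ (p / r) by rewrite mulr_ge0 ?powR_ge0.
have v0 y : 0 <= g y `^ (p / r') by rewrite powR_ge0.
have := ge0_hoelder m2 mu (mgp (p / r')) u0 v0 r0 r'0 rr'.
under [X in (_ <= X `^ _ * _)%E -> _]eq_integral do rewrite E1.
under [X in (_ <= _ * X `^ _)%E -> _]eq_integral do rewrite E2.
rewrite -/G => h.
have I0 : (0 <= \int[m2]_y (K1 (x, y) `^ q * g y `^ p)%:E)%E.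
  by apply: integral_ge0 => y _; rewrite lee_fin mulr_ge0 ?powR_ge0.
apply: (@le_trans _ _ (((\int[m2]_y (K1 (x, y) `^ q * g y `^ p)%:E) `^ r^-1 *
    G `^ r'^-1) `^ r)%E).
  apply: gt0_ler_poweR h; rewrite ?(ltW r0)// in_itv/= leey andbT.
    by apply: integral_ge0 => y _; rewrite lee_fin mulr_ge0 ?powR_ge0.
  by rewrite mule_ge0 ?poweR_ge0.
rewrite poweRM ?poweR_ge0// -!poweRrM mulVf ?gt_eqF// poweRe1//.
rewrite muleC (_ : r'^-1 * r = r - 1)//.
by rewrite /r'; field; rewrite !gt_eqF// subr_gt0.
Qed.

Lemma schur : (\int[m1]_x (\int[m2]_y (K1 (x, y) * K2 (x, y) * g y)%:E) `^ q <=
  B%:E * (\int[m2]_y (g y `^ p)%:E) `^ (q / p))%E.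
Proof.
rewrite -/G; have [Goo|Goo] := eqVneq G +oo%E.
  by rewrite Goo poweRyr ?mulf_neq0 ?invr_eq0 ?gt_eqF// gt0_muley ?leey.
have {}Goo : (G < +oo)%E by rewrite ltey.
have mF : measurable_fun [set: T1 * T2]
    (fun z => (((A z.1 * K1 z) `^ q) * g z.2 `^ p)%:E).
  apply/measurable_EFinP; apply: measurable_funM.
    apply: (measurableT_comp (measurable_powR _)).
    apply: measurable_funM => //; exact: (measurableT_comp mA measurable_fst).
  apply: (measurableT_comp (measurable_powR _)).
  exact: (measurableT_comp mg measurable_snd).
have F0 z : (0 <= (((A z.1 * K1 z) `^ q) * g z.2 `^ p)%:E)%E.
  by rewrite lee_fin mulr_ge0 ?powR_ge0.
apply: (@le_trans _ _ (\int[m1]_x (G `^ (q / p - 1) *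
    \int[m2]_y ((A x * K1 (x, y)) `^ q * g y `^ p)%:E))%E).
  apply: le_integral_ge0 => x; first exact: poweR_ge0.
  have Ip : (0 <= \int[m2]_y ((K1 (x, y) * g y) `^ p)%:E)%E.
    by apply: integral_ge0 => y _; rewrite lee_fin powR_ge0.
  apply: (@le_trans _ _ (((A x)%:E * (\int[m2]_y ((K1 (x, y) * g y) `^ p)%:E) `^ p^-1) `^ q)%E).
    apply: gt0_ler_poweR (schur_step1 x); rewrite ?(ltW q0)// in_itv/= leey andbT.
      by apply: integral_ge0 => y _; rewrite lee_fin !mulr_ge0.
    by rewrite mule_ge0 ?lee_fin ?poweR_ge0.
  rewrite poweRM ?lee_fin ?poweR_ge0// -poweRrM (mulrC p^-1).
  apply: (@le_trans _ _ (((A x)%:E `^ q) * (G `^ (q / p - 1) * \int[m2]_y (K1 (x, y) `^ q * g y `^ p)%:E))%E).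
    by rewrite lee_wpmul2l ?poweR_ge0// schur_step2.
  rewrite muleCA lee_wpmul2l ?poweR_ge0// poweR_EFin.
  rewrite -ge0_integralZl//; last 3 first.
  - apply/measurable_EFinP; apply: measurable_funM => //;
      exact: (measurableT_comp (measurable_powR _)).
  - by move=> y _; rewrite lee_fin mulr_ge0 ?powR_ge0.
  - by rewrite lee_fin powR_ge0.
  apply: le_integral_ge0 => y; first by rewrite mule_ge0 ?lee_fin ?mulr_ge0 ?powR_ge0.
  by rewrite -EFinM mulrA powRM.
rewrite ge0_integralZl//; last 3 first.
- exact: (measurable_fun_fubini_tonelli_F (fun z => (((A z.1 * K1 z) `^ q) * g z.2 `^ p)%:E)).
- by move=> x _; apply: integral_ge0 => y _; exact: (F0 (x, y)).
- exact: poweR_ge0.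
have F1 := @fubini_tonelli _ _ _ _ R m1 m2 (fun z => (((A z.1 * K1 z) `^ q) * g z.2 `^ p)%:E) mF F0.
rewrite /= in F1; rewrite F1 {F1}.
apply: (@le_trans _ _ (G `^ (q / p - 1) * (\int[m2]_y (B%:E * (g y `^ p)%:E)))%E).
  rewrite lee_wpmul2l ?poweR_ge0//; apply: le_integral_ge0 => y.
    by apply: integral_ge0 => x _; exact: (F0 (x, y)).
  under eq_integral do rewrite EFinM.
  rewrite ge0_integralZr//; last 3 first.
  - apply/measurable_EFinP; apply: (measurableT_comp (measurable_powR _)).
    by apply: measurable_funM => //; exact: measurableT_comp.
  - by move=> x _; rewrite lee_fin powR_ge0.
  - by rewrite lee_fin powR_ge0.
  by rewrite lee_wpmul2r ?lee_fin ?powR_ge0.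
rewrite ge0_integralZl ?lee_fin ?(ltW B0)//; last 2 first.
- by apply/measurable_EFinP; exact: (measurableT_comp (measurable_powR _)).
- by move=> x _; rewrite lee_fin powR_ge0.
rewrite -/G muleCA lee_wpmul2l ?lee_fin ?(ltW B0)//.
have Gfin : G \is a fin_num by rewrite ge0_fin_numE.
rewrite -[G]fineK// !poweR_EFin -EFinM lee_fin -{2}(@powRr1 _ (fine G)) ?fine_ge0//.
by rewrite -powRD subrK// mulf_eq0 invr_eq0 (gt_eqF q0) (gt_eqF p1).
Qed.

End schur.

(** * Integrals of powers against a measure of power growth *)

Lemma measurable_boolR d (T : measurableType d) (R : realType) (b : T -> bool) :
  measurable_fun [set: T] b -> measurable_fun [set: T] (fun x => (b x)%:R : R).
Proof.
move=> mb; rewrite (_ : (fun _ => _) = (fun x => if b x then 1 else 0)).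
  by apply: measurable_fun_ifT => //; exact: measurable_cst.
by apply/funext => x; case: (b x).
Qed.

Lemma powR_half_le (R : realType) (r x c : R) : 0 < r -> r / 2 < x -> x <= r ->
  x `^ (- c) <= 2 `^ `|c| * r `^ (- c).
Proof.
move=> r0 rx xr; have x0 : 0 < x by rewrite (lt_trans _ rx) ?divr_gt0.
have [c0|c0] := leP 0 c.
  rewrite (ger0_norm c0).
  have -> : 2 `^ c * r `^ (- c) = (r / 2) `^ (- c).
    rewrite [RHS]powRM ?invr_ge0 ?(ltW r0)// mulrC; congr (_ * _).
    by rewrite -(@powR_inv1 _ 2)// -powRrM mulrNN mul1r.
  rewrite !powRN lef_pV2 ?posrE ?powR_gt0 ?divr_gt0//.
  by rewrite ge0_ler_powR ?nnegrE ?divr_ge0 ?(ltW r0) ?(ltW x0) ?(ltW rx).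
rewrite (ltr0_norm c0) (le_trans (y := r `^ (- c)))//.
  by rewrite ge0_ler_powR ?nnegrE ?oppr_ge0 ?(ltW c0) ?(ltW x0) ?(ltW r0).
by rewrite ler_peMl ?powR_ge0// -[leLHS](powRr0 2) ler_powR ?ler1n// oppr_ge0 ltW.
Qed.

Lemma pow2_lt1 (R : realType) (x : R) : x < 0 -> 2 `^ x < 1.
Proof.
move=> x0; rewrite -[x]opprK powRN invf_lt1 ?powR_gt0//.
rewrite -[ltLHS](congr1 (@^~ (- x)) (powR1 R)).
by rewrite gt0_ltr_powR ?nnegrE ?oppr_gt0 ?ltr1n.
Qed.

Lemma lt_pow2 (R : realType) (x : R) : exists k : nat, x < 2 ^+ k.
Proof.
exists (Num.truncn x).+1; apply: lt_trans (truncnS_gt x) _.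
by rewrite -natrX ltr_nat ltn_expl.
Qed.

Lemma geometric_sum_le (R : realType) (z : R) k : 0 <= z -> z < 1 ->
  \sum_(0 <= j < k) z ^+ j <= (1 - z)^-1.
Proof.
move=> z0 z1; have z1' : 0 < 1 - z by rewrite subr_gt0.
rewrite -[leRHS]mulr1 ler_pdivlMl// big_mkord -opprB mulNr -subrX1 opprB.
by rewrite gerBl exprn_ge0.
Qed.

(** The loss from replacing phi^-c by its size on dyadic shells, times the sum
    of the geometric series of ratio 2^-|N - c|. *)
Definition dyadic_const (R : realType) (N c : R) : R :=
  2 `^ `|c| / (1 - 2 `^ (- `|N - c|)).

Lemma dyadic_const_gt0 (R : realType) (N c : R) : N != c -> 0 < dyadic_const N c.
Proof.
move=> Nc; rewrite divr_gt0 ?powR_gt0// subr_gt0 pow2_lt1//.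
by rewrite oppr_lt0 normr_gt0 subr_eq0.
Qed.

Lemma measurable_powR_comp d (T : measurableType d) (R : realType)
    (f : T -> R) (a : R) :
  measurable_fun [set: T] f -> measurable_fun [set: T] (fun x => f x `^ a).
Proof. by move=> mf; exact: (measurableT_comp (measurable_powR a)). Qed.

Section dyadic.
Context d (T : measurableType d) (R : realType).
Variables (mu : {measure set T -> \bar R}) (phi w : T -> R).
Hypothesis mphi : measurable_fun [set: T] phi.
Hypothesis mw : measurable_fun [set: T] w.
Hypothesis w0 : forall y, 0 <= w y.
Variables (M N c : R).
Hypothesis M0 : 0 <= M.

Let growth (r : R) := (\int[mu]_y ((phi y <= r)%R%:R * w y)%:E <= (M * r `^ N)%:E)%E.

(** On the shell rho / 2 < phi <= rho the power phi^-c is comparable to rho^-c,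
    so the shell contributes at most a constant times rho^(N - c). *)
Lemma dyadic_integral (D : T -> bool) (rho : nat -> R) (S : R) :
  (forall j, 0 < rho j) -> (forall j, growth (rho j)) ->
  (forall y, D y -> exists j, rho j / 2 < phi y <= rho j) ->
  (forall k, \sum_(0 <= j < k) rho j `^ (N - c) <= S) ->
  (\int[mu]_y ((D y)%:R * (phi y `^ (- c) * w y))%:E <=
   (2 `^ `|c| * M * S)%:E)%E.
Proof.
move=> rho0 grho cover sumS.
pose F j y : \bar R := (2 `^ `|c| * rho j `^ (- c) * ((phi y <= rho j)%R%:R * w y))%:E.
have F0 j y : (0 <= F j y)%E by rewrite lee_fin !mulr_ge0 ?powR_ge0.
have mle j : measurable_fun [set: T] (fun y => (phi y <= rho j)%R%:R * w y : R).
  apply: measurable_funM => //; apply: measurable_boolR.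
  by apply: measurable_fun_ler => //; exact: measurable_cst.
have mF j : measurable_fun [set: T] (F j).
  by apply/measurable_EFinP; apply: measurable_funM => //; exact: measurable_cst.
apply: (@le_trans _ _ (\int[mu]_y (\sum_(0 <= j <oo) F j y))%E).
  apply: le_integral_ge0 => y.
    by rewrite lee_fin mulr_ge0// mulr_ge0 ?powR_ge0.
  have [Dy|_] := boolP (D y); last by rewrite mul0r nneseries_ge0.
  have [j /andP[j1 j2]] := cover _ Dy.
  apply: (@le_trans _ _ (F j y)).
    by rewrite lee_fin j2 !mul1r ler_wpM2r// powR_half_le.
  apply: (le_trans _ (@nneseries_lim_ge R (F ^~ y) xpredT 0 j.+1 _)) => //.
  by rewrite big_nat_recr//= leeDr// sume_ge0.
rewrite integral_nneseries//.
apply: (@le_trans _ _ (\sum_(0 <= j <oo) (2 `^ `|c| * M * rho j `^ (N - c))%:E)%E).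
  apply: lee_nneseries => j _; first by move=> _; apply: integral_ge0 => y _; exact: F0.
  rewrite /F; under eq_integral do rewrite EFinM.
  rewrite ge0_integralZl//; last 3 first.
  - exact/measurable_EFinP.
  - by move=> y _; rewrite lee_fin mulr_ge0.
  - by rewrite lee_fin mulr_ge0 ?powR_ge0.
  apply: (@le_trans _ _ ((2 `^ `|c| * rho j `^ (- c))%:E * (M * rho j `^ N)%:E)%E).
    by rewrite lee_wpmul2l ?lee_fin ?mulr_ge0 ?powR_ge0//; exact: grho.
  rewrite -EFinM lee_fin [N - c]addrC powRD ?(gt_eqF (rho0 j)) ?implybT//.
  by rewrite mulrACA !mulrA.
apply: lime_le.
  by apply: is_cvg_nneseries => j _ _; rewrite lee_fin !mulr_ge0 ?powR_ge0.
apply: nearW => k; rewrite sumEFin lee_fin -mulr_sumr ler_wpM2l//.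
by rewrite mulr_ge0 ?powR_ge0.
Qed.

(** The shells have radii r, r/2, r/4, and so on; as c < N the series is
    geometric and the outer shell dominates. *)
Lemma inner_power_integral (r : R) : 0 < r -> c < N ->
  (forall s, 0 < s -> s <= r -> growth s) ->
  (\int[mu]_y ((0 < phi y <= r)%R%:R * (phi y `^ (- c) * w y))%:E <=
   (M * dyadic_const N c * r `^ (N - c))%:E)%E.
Proof.
move=> r0 cN gr.
have -> : M * dyadic_const N c * r `^ (N - c) =
    2 `^ `|c| * M * (r `^ (N - c) / (1 - 2 `^ (c - N))).
  by rewrite /dyadic_const [`|N - c|]gtr0_norm ?subr_gt0// opprB; ring.
have rho0 j : 0 < r / 2 ^+ j by rewrite divr_gt0// exprn_gt0.
apply: (dyadic_integral rho0).
- move=> j; apply: gr => //; rewrite ler_pdivrMr ?exprn_gt0//.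
  by rewrite ler_peMr ?(ltW r0) ?exprn_ege1 ?ler1n.
- move=> y /andP[y0 yr].
  have [k hk] := lt_pow2 (r / phi y).
  have exj : exists j, r / 2 ^+ j / 2 < phi y.
    exists k; rewrite -mulrA -invfM -exprSr ltr_pdivrMr ?exprn_gt0//.
    rewrite mulrC -ltr_pdivrMr// (lt_le_trans hk)// ler_eXn2l ?ltr1n//.
  exists (ex_minn exj); case: ex_minnP => -[h _|j hj jmin].
    by rewrite h expr0 divr1.
  rewrite hj/= leNgt; apply/negP => hlt.
  suff : (j.+1 <= j)%N by rewrite ltnn.
  by apply: jmin; rewrite -mulrA -invfM -exprSr.
- move=> k.
  rewrite (eq_bigr (fun j => r `^ (N - c) * (2 `^ (c - N)) ^+ j)); last first.
    move=> j _; rewrite powRM ?invr_ge0 ?exprn_ge0 ?(ltW r0)//; congr (_ * _).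
    have e2 : 2 ^- j = 2 `^ (- j%:R) :> R by rewrite powR_invn.
    have e3 : (2 `^ (c - N)) ^+ j = 2 `^ (c - N) `^ j%:R :> R.
      by rewrite powR_mulrn ?powR_ge0.
    rewrite e2 e3 -!powRrM; congr (2 `^ _); ring.
  rewrite -mulr_sumr ler_wpM2l ?powR_ge0// geometric_sum_le ?powR_ge0//.
  by rewrite pow2_lt1// subr_lt0.
Qed.

(** The shells have radii 2r, 4r, 8r, and so on; as N < c the inner shell
    dominates. *)
Lemma tail_power_integral (r : R) : 0 < r -> N < c ->
  (forall s, r <= s -> growth s) ->
  (\int[mu]_y ((r < phi y)%R%:R * (phi y `^ (- c) * w y))%:E <=
   (M * dyadic_const N c * r `^ (N - c))%:E)%E.
Proof.
move=> r0 cN gr.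
have -> : M * dyadic_const N c * r `^ (N - c) =
    2 `^ `|c| * M * (r `^ (N - c) / (1 - 2 `^ (N - c))).
  by rewrite /dyadic_const [`|N - c|]ltr0_norm ?subr_lt0// opprK; ring.
have rho0 j : 0 < r * 2 ^+ j.+1 by rewrite mulr_gt0// exprn_gt0.
have zlt1 : 2 `^ (N - c) < 1.
  by rewrite pow2_lt1// subr_lt0.
apply: (dyadic_integral rho0).
- move=> j; apply: gr => //; by rewrite ler_peMr ?(ltW r0) ?exprn_ege1 ?ler1n.
- move=> y ry; have [k hk] := lt_pow2 (phi y / r).
  have exj : exists j, phi y <= r * 2 ^+ j.+1.
    exists k; rewrite mulrC -ler_pdivrMr// ltW// (lt_le_trans hk)//.
    by rewrite ler_eXn2l ?ltr1n.
  exists (ex_minn exj); case: ex_minnP => -[h _|j hj jmin].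
    by rewrite h expr1 mulfK ?ry.
  rewrite hj andbT exprSr mulrA mulfK// ltNge; apply/negP => hlt.
  suff : (j.+1 <= j)%N by rewrite ltnn.
  exact: jmin.
- move=> k.
  rewrite (eq_bigr (fun j => (r `^ (N - c) * 2 `^ (N - c)) * (2 `^ (N - c)) ^+ j)); last first.
    move=> j _; rewrite powRM ?exprn_ge0 ?(ltW r0)// -mulrA -exprS; congr (_ * _).
    have e2 : 2 ^+ j.+1 = 2 `^ j.+1%:R :> R by rewrite powR_mulrn.
    have e3 : (2 `^ (N - c)) ^+ j.+1 = 2 `^ (N - c) `^ j.+1%:R :> R.
      by rewrite powR_mulrn ?powR_ge0.
    rewrite e2 e3 -!powRrM; congr (2 `^ _); exact: mulrC.
  rewrite -mulr_sumr ler_pM ?mulr_ge0 ?powR_ge0//.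
  - by rewrite sumr_ge0// => j _; rewrite exprn_ge0 ?powR_ge0.
  - by rewrite ler_piMr ?powR_ge0 ?(ltW zlt1).
  - by rewrite geometric_sum_le ?powR_ge0.
Qed.

End dyadic.

(** * The A_1 condition for powers of the distance *)

Lemma le_powRN (R : realType) (x y t : R) : 0 <= t -> 0 < x -> x <= y ->
  y `^ (- t) <= x `^ (- t).
Proof.
move=> t0 x0 xy; have y0 := lt_le_trans x0 xy.
rewrite [leLHS]powRN [leRHS]powRN lef_pV2 ?posrE ?powR_gt0//.
by rewrite ge0_ler_powR ?nnegrE ?(ltW x0) ?(ltW y0).
Qed.

(** If b >= a the first term suffices; if 0 < b < a then (a / b)^t <= (a / b)^s. *)
Lemma powRN_interp (R : realType) (a b t s : R) : 0 <= t -> t <= s ->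
  0 < a -> 0 <= b -> b `^ (- t) <= a `^ (- t) + a `^ (s - t) * b `^ (- s).
Proof.
move=> t0 ts a0; rewrite le_eqVlt => /predU1P[<-|b0].
  have [->|tn0] := eqVneq t 0.
    by rewrite oppr0 !powRr0 lerDl mulr_ge0 ?powR_ge0.
  by rewrite powR0 ?oppr_eq0// addr_ge0 ?mulr_ge0 ?powR_ge0.
have [ab|ba] := leP a b.
  apply: (le_trans (le_powRN t0 a0 ab)).
  by rewrite lerDl mulr_ge0 ?powR_ge0.
apply: (@le_trans _ _ (a `^ (s - t) * b `^ (- s))); last first.
  by rewrite lerDr powR_ge0.
rewrite [X in b `^ X](_ : _ = (s - t) + - s); last by ring.
rewrite powRD ?(gt_eqF b0) ?implybT//; apply: ler_wpM2r; first exact: powR_ge0.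
apply: ge0_ler_powR; last exact: ltW.
- by rewrite subr_ge0.
- by rewrite nnegrE ltW.
- by rewrite nnegrE ltW.
Qed.

Lemma sup_ballE_cube (R : realType) n (x : 'rV[R]_n) (r : R) : 0 <= r ->
  [set y : 'rV[R]_n | `|y - x| <= r] = cube (x - const_mx r) (r *+ 2).
Proof. by move=> r0; apply/seteqP; split => y /(sup_normE_cube _ _ r0). Qed.

Lemma measurable_sup_ball (R : realType) n (x : 'rV[R]_n) (r : R) : 0 <= r ->
  measurable [set y : 'rV[R]_n | `|y - x| <= r].
Proof. by move=> r0; rewrite sup_ballE_cube//; exact: measurable_cube. Qed.

Section dist_weight.
Context {R : realType} {n : nat}.
Variables (E : set 'rV[R]_n) (alpha : R).
Hypothesis E0 : E !=set0.
Hypothesis alpha0 : 0 < alpha.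
Hypothesis A1E : A1 (dist_pow E (- alpha)).
Local Notation mu := (lebesgue_rV R n).
Local Notation d := (dist ^~ E).
Implicit Types x y : 'rV[R]_n.

Lemma dist_pow_ge0 a x : (0 <= dist_pow E a x)%E.
Proof. by rewrite /dist_pow; case: ifPn => // _; rewrite lee_fin powR_ge0. Qed.

Lemma powR_le_dist_pow a x : ((d x `^ a)%:E <= dist_pow E a x)%E.
Proof. by rewrite /dist_pow; case: ifPn => // _; rewrite leey. Qed.

(** Close to x the distance is at least d(x) / 2, and every neighbourhood of x
    has positive measure. *)
Lemma ess_inf_le_near x r : 0 < d x -> 0 < r ->
  (ess_inf (mrestr mu (measurable_cube (x - const_mx r) (r *+ 2)))
     (dist_pow E (- alpha)) <= ((d x / 2) `^ (- alpha))%:E)%E.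
Proof.
move=> dx r1; set m := mrestr _ _; set e := ess_inf _ _.
have [N [mN N0 sub]] := ess_inf_le m (dist_pow E (- alpha)).
(* n + 1 instead of the Lipschitz constant n keeps the quotient meaningful
   for n = 0 *)
pose s := Num.min r (d x / 2 / (n%:R + 1)).
have n1 : 0 < n%:R + 1 :> R by rewrite ltr_wpDl.
have s0 : 0 < s by rewrite lt_min r1 !divr_gt0.
have [sr sd] : s <= r /\ s <= d x / 2 / (n%:R + 1).
  by split; rewrite ge_min lexx ?orbT.
apply: contrapT => /negP; rewrite -ltNge => he.
have subN : [set y : 'rV[R]_n | `|y - x| <= s] `<=`
    N `&` cube (x - const_mx r) (r *+ 2).
  move=> y /= ys; split; last first.
    by apply/(sup_normE_cube _ _ (ltW r1)); exact: le_trans ys sr.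
  apply: sub => /= ely.
  have dy : d x / 2 <= d y.
    have := dist_lipschitz x y E0; rewrite distrC.
    have : n%:R * `|y - x| <= d x / 2.
      apply: (@le_trans _ _ ((n%:R + 1) * s)).
        by rewrite ler_pM// lerDl.
      by rewrite mulrC -ler_pdivlMr.
    by lra.
  have dy0 : 0 < d y by rewrite (lt_le_trans _ dy)// divr_gt0.
  have := lt_le_trans he ely; rewrite /dist_pow gt_eqF//= lte_fin.
  rewrite !powRN ltf_pV2 ?posrE ?powR_gt0 ?divr_gt0//; apply/negP; rewrite -leNgt.
  by rewrite ge0_ler_powR ?nnegrE ?(ltW alpha0) ?(ltW dy0) ?divr_ge0 ?(ltW dx).
have mcube := measurable_sup_ball x (ltW s0).
have := le_measure mu (_ : _ \in measurable) (_ : _ \in measurable) subN.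
rewrite !inE => /(_ mcube (measurableI _ _ mN (measurable_cube _ _))).
move=> h; have {h} : (mu [set y : 'rV[R]_n | (`|y - x| <= s)%R] <= 0)%E by rewrite -N0.
rewrite lebesgue_rV_cube ?(ltW s0)// lee_fin leNgt exprn_gt0//.
by rewrite pmulrn_lgt0.
Qed.

(** The average over the cube is at most a constant times the essential
    infimum, which is controlled by the value at the centre. *)
Lemma A1_cube_integral : exists2 K : R, 0 < K & forall x r, 0 < d x -> 0 < r ->
  (\int[mu]_(y in [set y : 'rV[R]_n | (`|y - x| <= r)%R]) dist_pow E (- alpha)%R y <=
   (K * r `^ n%:R * d x `^ (- alpha))%:E)%E.
Proof.
have [k k0 hk] : exists2 k : R, 0 < k & (A1_constant (dist_pow E (- alpha)) <= k%:E)%E.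
  case: A1E => _; case: (A1_constant _) => [k _|//|_]; last by exists 1 => //; rewrite leNye.
  exists (Num.max k 1); first by rewrite lt_max ltr01 orbT.
  by rewrite lee_fin le_max lexx.
exists (k * 2 `^ n%:R * 2 `^ alpha); first by rewrite !mulr_gt0// powR_gt0.
move=> x r dx r0.
have cubeE := sup_ballE_cube x (ltW r0).
have muc : mu (cube (x - const_mx r) (r *+ 2)) = ((r *+ 2) ^+ n)%:E.
  by rewrite -cubeE lebesgue_rV_cube ?(ltW r0).
set I := (X in (X <= _)%E).
have I0 : (0 <= I)%E by apply: integral_ge0 => y _; exact: dist_pow_ge0.
have := ess_inf_le_near dx r0.
set e := ess_inf _ _ => he.
have e0 : (0 <= e)%E by apply/ess_infP/nearW => y; exact: dist_pow_ge0.
have : (I / ((r *+ 2) ^+ n)%:E * e^-1 <= k%:E)%E.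
  apply: le_trans hk; apply: ereal_sup_ubound.
  exists (x - const_mx r) => //; exists (r *+ 2); first by rewrite /= pmulrn_lgt0.
  by rewrite /I cubeE muc.
have V0 : 0 < (r *+ 2) ^+ n by rewrite exprn_gt0// pmulrn_lgt0.
have -> : (k * 2 `^ n%:R * 2 `^ alpha * r `^ n%:R * d x `^ (- alpha))%:E =
  (k%:E * ((d x / 2) `^ (- alpha))%:E * ((r *+ 2) ^+ n)%:E)%E.
  rewrite -!EFinM; congr EFin; rewrite -[r *+ 2]mulr_natl exprMn -!powR_mulrn// ?(ltW r0)//.
  rewrite powRM ?invr_ge0 ?(ltW dx)// (_ : 2^-1 `^ (- alpha) = 2 `^ alpha).
    by ring.
  by rewrite -powR_inv1// -powRrM mulrNN mul1r.
rewrite inver gt_eqF//; case: e he e0 => [e|//|//] he e0.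
rewrite inver; have [e00|e1] := eqVneq e 0.
  have [<- _|I1] := eqVneq 0%E I.
    by rewrite !mule_ge0 ?lee_fin ?powR_ge0 ?(ltW k0) ?(ltW V0).
  by rewrite gt0_muley ?mule_gt0 ?lte_fin ?invr_gt0// lt0e eq_sym I1.
have {}e1 : 0 < e by rewrite lt_neqAle eq_sym e1 -lee_fin.
case: I I0 => [I I0|_|//]; last first.
  by rewrite gt0_mulye ?lte_fin ?invr_gt0// gt0_mulye ?lte_fin ?invr_gt0.
rewrite -!EFinM !lee_fin ler_pdivrMr// ler_pdivrMr// => /le_trans; apply.
by rewrite ler_pM2r// ler_pM2l.
Qed.

Lemma sup_ball_dist_le a x r : 0 <= r ->
  (\int[mu]_y ((`|y - x| <= r)%R%:R * d y `^ a)%:E <=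
   \int[mu]_(y in [set y : 'rV[R]_n | (`|y - x| <= r)%R]) dist_pow E a y)%E.
Proof.
move=> r0; rewrite [leRHS]integral_mkcond; apply: le_integral_ge0 => y.
  by rewrite lee_fin mulr_ge0 ?powR_ge0.
rewrite patchE; case: ifPn => [|].
  by rewrite inE => /= ->; rewrite mul1r; exact: powR_le_dist_pow.
by rewrite notin_setE => /= /negP/negbTE ->; rewrite mul0r.
Qed.

Lemma measurable_sup_ballR x r :
  measurable_fun [set: 'rV[R]_n] (fun y => (`|y - x| <= r)%R%:R : R).
Proof.
apply: measurable_boolR; apply: measurable_fun_ler; last exact: measurable_cst.
by apply: measurable_normB => //; exact: measurable_cst.
Qed.

Lemma measurable_dist_powR a : measurable_fun [set: 'rV[R]_n] (fun y => d y `^ a).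
Proof. by apply: (measurableT_comp (measurable_powR _)); exact: measurable_dist. Qed.

Lemma sup_ball_integral x r : 0 <= r ->
  (\int[mu]_y ((`|y - x| <= r)%R%:R)%:E = (2 `^ n%:R * r `^ n%:R)%:E)%E.
Proof.
move=> r0; rewrite -powRM// powR_mulrn ?mulr_ge0// mulr_natl.
rewrite -(lebesgue_rV_cube x)//.
transitivity (\int[mu]_y (\1_[set y : 'rV[R]_n | (`|y - x| <= r)%R] y)%:E)%E; last first.
  by rewrite integral_indic// ?setIT//; exact: measurable_sup_ball.
apply: eq_integral => y _; rewrite indicE; congr ((nat_of_bool _)%:R%:E).
by apply/idP/idP; rewrite inE.
Qed.

(** For t = alpha this is the A_1 condition; for smaller t, interpolate
    pointwise between 1 and d^-alpha with [powRN_interp]. *)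
Lemma A1_power_integral : exists2 K : R, 0 < K &
  forall t, 0 <= t -> t <= alpha -> forall x r, 0 < d x -> 0 < r ->
  (\int[mu]_y ((`|y - x| <= r)%R%:R * d y `^ (- t))%:E <=
   (K * r `^ n%:R * d x `^ (- t))%:E)%E.
Proof.
have [K K0 hK] := A1_cube_integral.
exists (2 `^ n%:R + K); first by rewrite addr_gt0// powR_gt0.
move=> t t0 ta x r dx r0.
have ptw y := powRN_interp t0 ta dx (dist_ge0 y E).
have mB := measurable_sup_ballR x r.
apply: (@le_trans _ _ (\int[mu]_y (((d x `^ (- t))%:E * ((`|y - x| <= r)%R%:R)%:E) +
   ((d x `^ (alpha - t))%:E * ((`|y - x| <= r)%R%:R * d y `^ (- alpha))%:E)))%E).
  apply: le_integral_ge0 => y; first by rewrite lee_fin mulr_ge0 ?powR_ge0.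
  rewrite -!EFinM -EFinD lee_fin.
  case: (`|y - x| <= r); last by rewrite !(mulr0, mul0r) addr0.
  by rewrite !(mulr1, mul1r) ptw.
have mdB : measurable_fun [set: 'rV[R]_n]
    (fun y => (`|y - x| <= r)%R%:R * d y `^ (- alpha) : R).
  by apply: measurable_funM => //; exact: measurable_dist_powR.
rewrite ge0_integralD//; last 4 first.
- by move=> y _; rewrite -EFinM lee_fin mulr_ge0 ?powR_ge0.
- by apply/measurable_EFinP; apply: measurable_funM.
- by move=> y _; rewrite -EFinM lee_fin !mulr_ge0 ?powR_ge0.
- by apply/measurable_EFinP; apply: measurable_funM.
rewrite ge0_integralZl ?lee_fin ?powR_ge0//; last exact/measurable_EFinP.
rewrite ge0_integralZl ?lee_fin ?powR_ge0//; last 2 first.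
- exact/measurable_EFinP.
- by move=> y _; rewrite lee_fin mulr_ge0 ?powR_ge0.
rewrite sup_ball_integral ?(ltW r0)//.
apply: (@le_trans _ _ ((d x `^ (- t))%:E * (2 `^ n%:R * r `^ n%:R)%:E +
   (d x `^ (alpha - t))%:E * (K * r `^ n%:R * d x `^ (- alpha))%:E)%E).
  rewrite leeD// lee_wpmul2l ?lee_fin ?powR_ge0//.
  by rewrite (le_trans (sup_ball_dist_le _ _ (ltW r0)))// hK.
rewrite -!EFinM -EFinD lee_fin [X in _ + X]mulrC -[X in _ + X]mulrA.
rewrite -powRD ?(gt_eqF dx) ?implybT// (_ : - alpha + (alpha - t) = - t); last by ring.
by rewrite le_eqVlt; apply/orP; left; apply/eqP; ring.
Qed.

(** The weight is infinite where the distance vanishes, and locally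
    integrable. *)
Lemma dist0_null (x0 : 'rV[R]_n) : 0 < d x0 -> mu [set y : 'rV[R]_n | d y = 0] = 0%E.
Proof.
move=> dx0; have [K K0 hK] := A1_cube_integral.
have mN : measurable [set y : 'rV[R]_n | d y = 0].
  by have := measurable_dist E0 measurableT (measurable_set1 0); rewrite setTI.
pose Q k := [set y : 'rV[R]_n | `|y - x0| <= k.+1%:R].
have mQ k : measurable (Q k) by exact: measurable_sup_ball.
have NQ k : mu ([set y : 'rV[R]_n | d y = 0] `&` Q k) = 0%E.
  apply: contrapT => /eqP NQ0.
  have := hK x0 k.+1%:R dx0 (ltr0Sn _ _).
  rewrite leNgt => /negP; apply; apply: lt_le_trans (ltry _) _.
  apply: (@le_trans _ _ (\int[mu]_(y in [set y : 'rV[R]_n | d y = 0%R] `&` Q k) (cst +oo y))%E).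
    rewrite integral_cst; last exact: measurableI.
    by rewrite gt0_mulye// lt0e NQ0 measure_ge0.
  rewrite integral_mkcond [leRHS]integral_mkcond; apply: le_integral_ge0 => y.
    by rewrite patchE; case: ifPn => // _; rewrite leey.
  rewrite !patchE; case: ifPn => [|_].
    rewrite inE => -[/= dy Qy]; rewrite mem_set//.
    by rewrite /dist_pow dy eqxx oppr_lt0 alpha0.
  by case: ifPn => // _; exact: dist_pow_ge0.
apply: (iffLR (negligibleP _ mN)).
rewrite (_ : [set y : 'rV[R]_n | d y = 0] = \bigcup_k ([set y : 'rV[R]_n | d y = 0] `&` Q k)).
  apply: negligible_bigcup => k.
  by exists ([set y : 'rV[R]_n | d y = 0] `&` Q k); split; [exact: measurableI|exact: NQ|].
rewrite -setI_bigcupr; apply/esym/setIidPl => y _.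
exists (Num.truncn `|y - x0|) => //=; exact/ltW/truncnS_gt.
Qed.

Variable x0 : 'rV[R]_n.
Variable r0 : R.
Hypothesis r0_gt0 : 0 < r0.
Hypothesis Er0 : forall y, E y -> enorm (y - x0) <= r0.
Hypothesis n0 : (0 < n)%N.

Lemma sup_norm_le_dist x : `|x - x0| <= d x + r0.
Proof.
rewrite -lerBlDr; apply: le_dist => // y Ey; rewrite lerBlDr.
rewrite (le_trans (sup_norm_le_enorm _))//.
rewrite (_ : x - x0 = (x - y) + (y - x0)); last by rewrite addrA subrK.
by rewrite (le_trans (ler_enormD _ _))// lerD2l Er0.
Qed.

(** All coordinates of x0 are shifted by r, and there is at least one. *)
Lemma far_point r : 0 < r -> exists x : 'rV[R]_n, `|x - x0| = r.
Proof.
move=> hr; exists (x0 + const_mx r); rewrite addrC addKr.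
apply/eqP; rewrite eq_le; apply/andP; split.
  by apply/(sup_normP _ (ltW hr)) => i; rewrite mxE gtr0_norm.
by apply: le_trans (sup_norm_coord _ (Ordinal n0)); rewrite mxE gtr0_norm.
Qed.

Lemma dist0_negligible : mu [set y : 'rV[R]_n | d y = 0] = 0%E.
Proof.
have [x hx] := @far_point (r0 *+ 2) ltac:(by rewrite pmulrn_lgt0).
have h := sup_norm_le_dist x; rewrite hx in h.
apply: (@dist0_null x); apply: lt_le_trans r0_gt0 _.
by rewrite -(lerD2r r0) -mulr2n.
Qed.

(** The set where d + r0 <= r lies in the cube of centre x0 and radius r, hence
    in the cube of radius 3 r around a point x with |x - x0| = 2 r.  For r >= r0
    such an x has d(x) >= r, and for r < r0 the set is empty. *)
Lemma A1_power_growth : exists2 K : R, 0 < K &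
  forall t, 0 <= t -> t <= alpha -> forall r, 0 < r ->
  (\int[mu]_y ((d y + r0 <= r)%R%:R * d y `^ (- t))%:E <=
   (K * r `^ (n%:R - t))%:E)%E.
Proof.
have [K K0 hK] := A1_power_integral.
exists (K * 3 `^ n%:R); first by rewrite mulr_gt0// powR_gt0.
move=> t t0 ta r hr.
have [rr0|r0r] := ltP r r0.
  rewrite (eq_integral (cst 0%E)).
    by rewrite integral0 lee_fin !mulr_ge0 ?powR_ge0 ?(ltW K0).
  move=> y _; rewrite (_ : (_ <= r) = false) ?mul0r//.
  by apply/negbTE; rewrite -ltNge (lt_le_trans rr0)// lerDr dist_ge0.
have [x hx] := @far_point (r *+ 2) ltac:(by rewrite pmulrn_lgt0).
have dxr : r <= d x.
  have h := sup_norm_le_dist x; rewrite hx mulr2n in h.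
  by rewrite -(lerD2r r) (le_trans h)// lerD2l.
have dx0 : 0 < d x by rewrite (lt_le_trans hr).
apply: (@le_trans _ _ (\int[mu]_y ((`|y - x| <= r *+ 3)%R%:R * d y `^ (- t))%:E)%E).
  apply: le_integral_ge0 => y; first by rewrite lee_fin mulr_ge0 ?powR_ge0.
  rewrite lee_fin ler_wpM2r ?powR_ge0//.
  have [yr|_] := leP (d y + r0) r; last by rewrite ler0n.
  rewrite (_ : _ <= _)// (_ : y - x = (y - x0) + (x0 - x)); last by rewrite addrA subrK.
  rewrite (le_trans (ler_normD _ _))// mulrS [`|x0 - x|]distrC hx lerD2r.
  exact: le_trans (sup_norm_le_dist y) yr.
apply: le_trans (hK t t0 ta x (r *+ 3) dx0 ltac:(by rewrite pmulrn_lgt0)) _.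
rewrite lee_fin -[r *+ 3]mulr_natl powRM ?(ltW hr)// powRD ?(gt_eqF hr) ?implybT//.
rewrite !mulrA ler_wpM2l ?mulr_ge0 ?powR_ge0 ?(ltW K0)//.
exact: le_powRN.
Qed.

End dist_weight.

(** * The weighted Riesz potential *)

Lemma powR_boolr (R : realType) (b : bool) (a : R) : a != 0 ->
  (b%:R : R) `^ a = b%:R.
Proof. by move=> a0; case: b; rewrite ?powR1 ?powR0. Qed.

Definition bounded_kernel (R : realType) d (T : measurableType d)
    (mu : {measure set T -> \bar R}) (p q : R) (k : T * T -> R) :=
  exists2 B : R, 0 < B & forall g : T -> R,
    measurable_fun [set: T] g -> (forall y, 0 <= g y) ->
    (\int[mu]_x (\int[mu]_y (k (x, y) * g y)%:E) `^ q <=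
     B%:E * (\int[mu]_y (g y `^ p)%:E) `^ (q / p))%E.

Lemma measurable_poweR_comp d (T : measurableType d) (R : realType)
    (F : T -> \bar R) (q : R) : 0 < q ->
  measurable_fun [set: T] F -> (forall x, 0 <= F x)%E ->
  measurable_fun [set: T] (fun x => (F x `^ q)%E).
Proof.
move=> q0 mF F0.
have -> : (fun x => (F x `^ q)%E) = er_map (fun y => y `^ q) \o F.
  by apply/funext => x /=; case: (F x) (F0 x) => //= _; rewrite gt_eqF.
exact: (measurableT_comp (measurable_er_map T (measurable_powR q)) mF).
Qed.

Lemma poweRD_le (R : realType) (q : R) (u v : \bar R) : 0 <= q ->
  (0 <= u)%E -> (0 <= v)%E ->
  ((u + v) `^ q <= (2 `^ q)%:E * (u `^ q + v `^ q))%E.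
Proof.
move=> q0; wlog uv : u v / (u <= v)%E.
  move=> H u0 v0; have [uv|vu] := leP u v; first exact: H.
  by rewrite addeC [(u `^ _ + _)%E]addeC; apply: H => //; exact: ltW.
move=> u0 v0; apply: (@le_trans _ _ ((2%:E * v) `^ q)%E).
  apply: gt0_ler_poweR => //; rewrite ?in_itv/= ?leey ?andbT ?adde_ge0 ?mule_ge0//.
  by rewrite mule_natl mule2n leeD.
by rewrite poweRM ?lee_fin// lee_wpmul2l ?lee_fin ?powR_ge0// leeDr// poweR_ge0.
Qed.

Section kernel_definitions.
Context {R : realType} {n : nat}.
Variables (d m : 'rV[R]_n -> R) (b Th : R).
Implicit Types z : 'rV[R]_n * 'rV[R]_n.

(** The Riesz kernel of order one, conjugated by the weight d^b and damped by
    m^-Th in the first variable z.1. *)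
Definition riesz_kernel z : R :=
  d z.1 `^ b * m z.1 `^ (- Th) * d z.2 `^ (- b) * `|z.2 - z.1| `^ (1 - n%:R).

Definition near_kernel z : R :=
  (0 < `|z.2 - z.1| <= (2 * n%:R)^-1 * m z.1)%R%:R * riesz_kernel z.

Definition far_kernel z : R :=
  m z.1 `^ (b - Th) * d z.2 `^ (- b) * Num.max (m z.1) (m z.2) `^ (1 - n%:R).

Lemma riesz_kernel_ge0 z : 0 <= riesz_kernel z.
Proof. by rewrite /riesz_kernel !mulr_ge0 ?powR_ge0. Qed.

Lemma near_kernel_ge0 z : 0 <= near_kernel z.
Proof. by rewrite /near_kernel mulr_ge0 ?riesz_kernel_ge0. Qed.

Lemma far_kernel_ge0 z : 0 <= far_kernel z.
Proof. by rewrite /far_kernel !mulr_ge0 ?powR_ge0. Qed.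

(** Off the near region m(x) < 2n |x - y|, hence m(y) <= 3n |x - y|, and
    |x - y|^(1 - n) is controlled by max(m(x), m(y))^(1 - n). *)
Lemma riesz_kernel_le z : (1 < n)%N -> 0 < b -> 0 < m z.1 ->
  0 <= d z.1 -> d z.1 <= m z.1 -> m z.2 <= m z.1 + n%:R * `|z.2 - z.1| ->
  riesz_kernel z <= near_kernel z + (3 * n%:R) `^ (n%:R - 1) * far_kernel z.
Proof.
move=> n1 b0 m0 d0 dm m21; rewrite /near_kernel.
have nn0 : 0 < n%:R :> R by rewrite ltr0n ltnW.
have n1' : 1 - n%:R != 0 :> R by rewrite subr_eq0 lt_eqF// ltr1n.
have n1g : 0 <= n%:R - 1 :> R by rewrite subr_ge0 ler1n ltnW.
have F0 : 0 <= (3 * n%:R) `^ (n%:R - 1) * far_kernel z.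
  by rewrite mulr_ge0 ?powR_ge0 ?far_kernel_ge0.
have [zn|zn] := boolP (0 < _ <= _); first by rewrite mul1r lerDl.
rewrite mul0r add0r; move: zn; rewrite negb_and -leNgt -ltNge => /orP[z0|zc].
  rewrite /riesz_kernel; have /eqP -> : `|z.2 - z.1| == 0 by rewrite eq_le z0 /=.
  by rewrite powR0// mulr0.
set r := `|z.2 - z.1| in m21 zc *; pose M := Num.max (m z.1) (m z.2).
have mr : m z.1 < 2 * n%:R * r.
  by rewrite -ltr_pdivrMl ?mulr_gt0.
have nr : 0 < n%:R * r by lra.
have r0 : 0 < r by move: nr; rewrite pmulr_rgt0.
have Mr : M <= 3 * n%:R * r.
  by rewrite /M ge_max; apply/andP; split; lra.
have M0 : 0 < M by rewrite lt_max m0.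
have rM : r `^ (1 - n%:R) <= (3 * n%:R) `^ (n%:R - 1) * M `^ (1 - n%:R).
  have -> : (3 * n%:R) `^ (n%:R - 1) * M `^ (1 - n%:R) =
      (M / (3 * n%:R)) `^ (- (n%:R - 1)).
    rewrite [RHS]powRM ?invr_ge0 ?(ltW M0) ?mulr_ge0 ?(ltW nn0)// opprB [LHS]mulrC.
    congr (_ * _).
    have -> : (3 * n%:R)^-1 = (3 * n%:R) `^ (- 1) :> R.
      by rewrite powR_inv1// mulr_ge0 ?(ltW nn0).
    by rewrite -powRrM mulN1r opprB.
  rewrite -[1 - n%:R]opprB; apply: le_powRN => //.
    by rewrite divr_gt0// mulr_gt0.
  by rewrite ler_pdivrMr ?mulr_gt0// mulrC.
apply: (@le_trans _ _ (d z.1 `^ b * m z.1 `^ (- Th) * d z.2 `^ (- b) *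
    ((3 * n%:R) `^ (n%:R - 1) * M `^ (1 - n%:R)))).
  by apply: ler_wpM2l rM; rewrite !mulr_ge0 ?powR_ge0.
have -> : (3 * n%:R) `^ (n%:R - 1) * far_kernel z =
    m z.1 `^ b * m z.1 `^ (- Th) * d z.2 `^ (- b) *
    ((3 * n%:R) `^ (n%:R - 1) * M `^ (1 - n%:R)).
  rewrite /far_kernel -/M powRD ?(gt_eqF m0) ?implybT//; ring.
rewrite -!mulrA; apply: ler_wpM2r; first by rewrite !mulr_ge0 ?powR_ge0.
by apply: ge0_ler_powR; rewrite ?nnegrE ?(ltW b0) ?(ltW m0).
Qed.

End kernel_definitions.

(** In this section d stands for the distance to E and r0 for the diameter of
    E. *)
Section kernels.
Context {R : realType} {n : nat}.
Variables (d : 'rV[R]_n -> R) (r0 p q beta alpha K : R) (x0 : 'rV[R]_n).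
Local Notation mu := (lebesgue_rV R n).
Local Notation nn := (n%:R : R).
Let m x := d x + r0.
Let p' := p / (p - 1).
Let s := beta / p * p'.
Let Th := 1 + nn * (q^-1 - p^-1).
Hypothesis d_ge0 : forall x, 0 <= d x.
Hypothesis md : measurable_fun [set: 'rV[R]_n] d.
Hypothesis dL : forall x y, d x <= d y + nn * `|x - y|.
Hypothesis r0_gt0 : 0 < r0.
Hypothesis dx0 : forall x, `|x - x0| <= d x + r0.
Hypothesis K0 : 0 < K.
Hypothesis hA : forall t, 0 <= t -> t <= alpha -> forall x r, 0 < d x -> 0 < r ->
  (\int[mu]_y ((`|y - x| <= r)%R%:R * d y `^ (- t))%:E <=
   (K * r `^ nn * d x `^ (- t))%:E)%E.
Hypothesis hB : forall t, 0 <= t -> t <= alpha -> forall r, 0 < r ->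
  (\int[mu]_y ((d y + r0 <= r)%R%:R * d y `^ (- t))%:E <=
   (K * r `^ (nn - t))%:E)%E.
Hypothesis p1 : 1 < p.
Hypothesis pq : p <= q.
Hypothesis Th0 : 0 < Th.
Hypothesis pn : p < nn.
Hypothesis beta0 : 0 < beta.
Hypothesis salpha : s < alpha.

Let p0 : 0 < p. Proof. exact: lt_trans p1. Qed.
Let q0 : 0 < q. Proof. exact: lt_le_trans pq. Qed.
Let p'0 : 0 < p'. Proof. by rewrite divr_gt0// subr_gt0. Qed.
Let p1' : 0 < p - 1. Proof. by rewrite subr_gt0. Qed.
Let pp' : p^-1 + p'^-1 = 1.
Proof. by rewrite /p'; field; rewrite !gt_eqF. Qed.
Let n1 : (1 < n)%N. Proof. by rewrite -(ltr1n R); exact: lt_trans pn. Qed.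
Let nn0 : 0 < nn. Proof. by rewrite ltr0n ltnW. Qed.
Let s0 : 0 < s. Proof. by rewrite /s mulr_gt0// divr_gt0. Qed.
Let m0 x : 0 < m x. Proof. by rewrite /m ltr_wpDl. Qed.
Let mm : measurable_fun [set: 'rV[R]_n] m.
Proof. by apply: measurable_funD. Qed.
Let np : nn / p - 1 = nn / q - Th. Proof. by rewrite /Th; ring. Qed.
Let np' : nn / p' = nn - nn / p.
Proof. by rewrite -[X in X - _](mulr1 nn) -pp'; ring. Qed.

Let mnorm : measurable_fun [set: 'rV[R]_n * 'rV[R]_n] (fun z => `|z.2 - z.1|).
Proof. exact: measurable_normB. Qed.

Let md1 : measurable_fun [set: 'rV[R]_n * 'rV[R]_n] (fun z => d z.1).
Proof. exact: (measurableT_comp md measurable_fst). Qed.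

Let md2 : measurable_fun [set: 'rV[R]_n * 'rV[R]_n] (fun z => d z.2).
Proof. exact: (measurableT_comp md measurable_snd). Qed.

Let mm1 : measurable_fun [set: 'rV[R]_n * 'rV[R]_n] (fun z => m z.1).
Proof. exact: (measurableT_comp mm measurable_fst). Qed.

Let mm2 : measurable_fun [set: 'rV[R]_n * 'rV[R]_n] (fun z => m z.2).
Proof. exact: (measurableT_comp mm measurable_snd). Qed.

Let ball_growth x r : 0 <= r ->
  (\int[mu]_y ((`|y - x| <= r)%R%:R * 1)%:E <= (2 `^ nn * r `^ nn)%:E)%E.
Proof.
by move=> r00; under eq_integral do rewrite mulr1; rewrite sup_ball_integral.
Qed.

Let m_growth r : 0 <= r ->
  (\int[mu]_y ((m y <= r)%R%:R * 1)%:E <= (2 `^ nn * r `^ nn)%:E)%E.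
Proof.
move=> r00; apply: le_trans (ball_growth x0 r00).
apply: le_integral_ge0 => y; first by rewrite lee_fin mulr_ge0.
rewrite lee_fin !mulr1 ler_nat; case: (leP (m y) r) => // my.
by rewrite (le_trans (dx0 y) my).
Qed.

(** The near part.  The power of |x - y| is shared so that K2^p' and (A K1)^q
    carry the exponents -n + p' Th/2 and -n + q Th/2, both integrable at 0 since
    Th > 0. *)
Section near.

Let c := (2 * nn)^-1.
Let c0 : 0 < c. Proof. by rewrite invr_gt0 mulr_gt0. Qed.
Let b := nn / p' - Th / 2.
Let near (z : 'rV[R]_n * 'rV[R]_n) : bool := 0 < `|z.2 - z.1| <= c * m z.1.
Let K1 z : R := (near z)%:R * (d z.1 `^ (beta / p) * m z.1 `^ (- Th) *
  `|z.2 - z.1| `^ (- (nn / q - Th / 2))).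
Let K2 z : R := (0 < d z.1)%R%:R * ((near z)%:R *
  (`|z.2 - z.1| `^ (- b) * d z.2 `^ (- (beta / p)))).

Let mnear : measurable_fun [set: 'rV[R]_n * 'rV[R]_n] (fun z => (near z)%:R : R).
Proof.
apply: measurable_boolR; apply: measurable_and.
  by apply: measurable_fun_ltr => //; exact: measurable_cst.
by apply: measurable_fun_ler => //; apply: measurable_funM => //; exact: measurable_cst.
Qed.

Let mK1 : measurable_fun [set: _] K1.
Proof.
apply: measurable_funM => //; apply: measurable_funM; last exact: measurable_powR_comp.
by apply: measurable_funM; exact: measurable_powR_comp.
Qed.

Let mK2 : measurable_fun [set: _] K2.
Proof.
apply: measurable_funM.
  by apply: measurable_boolR; apply: measurable_fun_ltr => //; exact: measurable_cst.
by apply: measurable_funM => //; apply: measurable_funM; exact: measurable_powR_comp.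
Qed.

Let K1_ge0 z : 0 <= K1 z.
Proof. by rewrite /K1 !mulr_ge0 ?powR_ge0. Qed.

Let K2_ge0 z : 0 <= K2 z.
Proof. by rewrite /K2 !mulr_ge0 ?powR_ge0. Qed.

Let e := p' * (Th / 2).
Let e0 : 0 < e. Proof. by rewrite mulr_gt0// divr_gt0. Qed.
Let bp' : b * p' = nn - e.
Proof. by rewrite /b /e mulrBl divfK ?(gt_eqF p'0)// mulrC. Qed.

Let C := (K * dyadic_const nn (nn - e) * c `^ e) `^ p'^-1.
Let C_ge0 : 0 <= C. Proof. exact: powR_ge0. Qed.
Let A x := C * (d x `^ (- (beta / p)) * m x `^ (Th / 2)).

Let HK2 x : (\int[mu]_y (K2 (x, y) `^ p')%:E <= (A x `^ p')%:E)%E.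
Proof.
have p'n0 : p' != 0 by rewrite gt_eqF.
(* On E both sides vanish: A(x) = 0 since 0 to a nonzero power is 0. *)
have [dx|dx] := ltP 0 (d x); last first.
  rewrite (eq_integral (cst 0%E)); first by rewrite integral0 lee_fin powR_ge0.
  by move=> y _; rewrite /K2 /= ltNge dx mul0r powR0.
have E y : K2 (x, y) `^ p' =
    (0 < `|y - x| <= c * m x)%R%:R * (`|y - x| `^ (- (nn - e)) * d y `^ (- s)).
  rewrite /K2 /= dx mul1r powRM ?mulr_ge0 ?powR_ge0// powR_boolr//; congr (_ * _).
  by rewrite powRM ?powR_ge0// -!powRrM !mulNr bp'.
under eq_integral do rewrite E.
have cm0 : 0 < c * m x by rewrite mulr_gt0.
have Kx0 : 0 <= K * d x `^ (- s) by rewrite mulr_ge0 ?powR_ge0 ?(ltW K0).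
have mnx : measurable_fun [set: 'rV[R]_n] (fun y => `|y - x|).
  by apply: measurable_normB => //; exact: measurable_cst.
have ne : nn - e < nn by rewrite gtrBl.
apply: (le_trans (inner_power_integral mnx (measurable_powR_comp (- s) md)
   (fun y => powR_ge0 _ _) Kx0 cm0 ne _)).
  move=> r hr _; rewrite mulrAC; apply: hA => //; exact: ltW.
rewrite lee_fin subKr /A powRM ?mulr_ge0 ?powR_ge0// powRM ?powR_ge0//.
rewrite -!powRrM mulVf// powRr1; last first.
  rewrite mulr_ge0 ?powR_ge0// mulr_ge0 ?(ltW K0)// ltW// dyadic_const_gt0//.
  by rewrite gt_eqF.
rewrite powRM ?(ltW c0) ?(ltW (m0 x))// mulNr -/s [Th / 2 * _]mulrC -/e.
by rewrite le_eqVlt; apply/orP; left; apply/eqP; ring.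
Qed.

Let f := q * (Th / 2).
Let f0 : 0 < f. Proof. by rewrite mulr_gt0// divr_gt0. Qed.

Let B := C `^ q * ((2 / 3) `^ (- f) * (2 `^ nn * dyadic_const nn (nn - f) * nn^-1 `^ f)) + 1.
Let B0 : 0 < B.
Proof.
have dc : 0 < dyadic_const nn (nn - f) by rewrite dyadic_const_gt0// gt_eqF// gtrBl.
rewrite /B ltr_wpDl//; do 2 (apply: mulr_ge0; first exact: powR_ge0).
by apply: mulr_ge0; [apply: mulr_ge0; [exact: powR_ge0|exact: ltW]|exact: powR_ge0].
Qed.

(** On the near region m(x) and m(y) are comparable, because d is
    Lipschitz. *)
Let near_m x y : near (x, y) -> 2 / 3 * m y <= m x /\ `|x - y| <= nn^-1 * m y.
Proof.
rewrite /near/= => /andP[_ h].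
have h1 : nn * `|y - x| <= m x / 2.
  have := ler_wpM2l (ltW nn0) h; rewrite /c invfM mulrA mulrCA divff ?gt_eqF// mulr1.
  by rewrite [2^-1 * _]mulrC.
have h2 := dL x y; have h3 := dL y x; rewrite [`|x - y|]distrC in h2 *.
rewrite -/(m x) in h1; split; first by rewrite /m in h1 *; lra.
by rewrite ler_pdivlMl//; rewrite /m in h1 *; lra.
Qed.

Let HK1 y : (\int[mu]_x ((A x * K1 (x, y)) `^ q)%:E <= B%:E)%E.
Proof.
have qn0 : q != 0 by rewrite gt_eqF.
pose D := C `^ q * (2 / 3 * m y) `^ (- f).
have D0 : 0 <= D by rewrite mulr_ge0 ?powR_ge0.
have Hp x : (A x * K1 (x, y)) `^ q <=
    D * ((0 < `|x - y| <= nn^-1 * m y)%R%:R * (`|x - y| `^ (- (nn - f)) * 1)).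
  have [nxy|nxy] := boolP (near (x, y)); last first.
    by rewrite /K1 (negbTE nxy) mul0r mulr0 powR0// !mulr_ge0 ?powR_ge0.
  have [h1 h2] := near_m nxy; move: (nxy); rewrite /near/= => /andP[xy0 _].
  rewrite h2 [`|x - y|]distrC xy0 /= mul1r mulr1 /A /K1 nxy mul1r /=.
  have -> : C * (d x `^ (- (beta / p)) * m x `^ (Th / 2)) *
     (d x `^ (beta / p) * m x `^ (- Th) * `|y - x| `^ (- (nn / q - Th / 2))) =
     C * ((d x `^ (- (beta / p)) * d x `^ (beta / p)) * (m x `^ (- (Th / 2)) *
      `|y - x| `^ (- (nn / q - Th / 2)))).
    have -> : m x `^ (- (Th / 2)) = m x `^ (Th / 2) * m x `^ (- Th).
      by rewrite -powRD ?(gt_eqF (m0 x)) ?implybT//; congr (_ `^ _); field.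
    ring.
  rewrite powRM ?mulr_ge0 ?powR_ge0// /D -[leRHS]mulrA; apply: ler_wpM2l; first exact: powR_ge0.
  rewrite powRM ?mulr_ge0 ?powR_ge0//.
  apply: (@le_trans _ _ (1 * (m x `^ (- (Th / 2)) * `|y - x| `^ (- (nn / q - Th / 2))) `^ q)).
    apply: ler_wpM2r; first exact: powR_ge0.
    have [->|dxn0] := eqVneq (d x) 0.
      rewrite [X in _ * X]powR0 ?mulr0 ?powR0 ?ler01//.
      by rewrite mulf_neq0 ?invr_eq0 ?(gt_eqF beta0) ?(gt_eqF p0).
    by rewrite powRN mulVf ?powR1// powR_eq0 (negbTE dxn0).
  rewrite mul1r powRM ?powR_ge0// -!powRrM.
  rewrite (_ : - (Th / 2) * q = - f); last by rewrite /f; ring.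
  rewrite (_ : - (nn / q - Th / 2) * q = - (nn - f)); last by rewrite /f; field.
  apply: ler_wpM2r; first exact: powR_ge0.
  by apply: le_powRN => //; [exact: ltW|rewrite mulr_gt0].
apply: (@le_trans _ _ (\int[mu]_x (D%:E *
    ((0 < `|x - y| <= nn^-1 * m y)%R%:R * (`|x - y| `^ (- (nn - f)) * 1))%:E))%E).
  apply: le_integral_ge0 => x; first by rewrite lee_fin powR_ge0.
  by rewrite -EFinM lee_fin; exact: Hp.
have mny : measurable_fun [set: 'rV[R]_n] (fun x => `|x - y|).
  by apply: measurable_normB => //; exact: measurable_cst.
have nm0 : 0 < nn^-1 * m y by rewrite mulr_gt0 ?invr_gt0.
rewrite ge0_integralZl ?lee_fin//; last first.
  apply/measurable_EFinP; apply: measurable_funM.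
    apply: measurable_boolR; apply: measurable_and.
      by apply: measurable_fun_ltr => //; exact: measurable_cst.
    by apply: measurable_fun_ler => //; exact: measurable_cst.
  by apply: measurable_funM => //; exact: measurable_powR_comp.
apply: (@le_trans _ _ (D%:E * (2 `^ nn * dyadic_const nn (nn - f) *
    (nn^-1 * m y) `^ (nn - (nn - f)))%:E)%E).
  apply: lee_wpmul2l; first by rewrite lee_fin.
  have nf : nn - f < nn by rewrite gtrBl.
  have := @inner_power_integral _ _ R mu (fun x => `|x - y|) (fun=> 1 : R) mny
    (measurable_cst (1 : R)) (fun=> ler01) (2 `^ nn) nn (nn - f)
    (powR_ge0 _ _) _ nm0 nf.
  by apply=> r hr _; apply: ball_growth; exact: ltW.
rewrite -EFinM lee_fin subKr /D /B.
have my0 := ltW (m0 y).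
rewrite [(2 / 3 * m y) `^ _]powRM ?divr_ge0//.
rewrite [(nn^-1 * m y) `^ _]powRM ?invr_ge0 ?(ltW nn0)//.
rewrite -[leLHS]addr0 lerD// le_eqVlt; apply/orP; left; apply/eqP.
have E : m y `^ (- f) * m y `^ f = 1.
  by rewrite powRN mulVf// gt_eqF// powR_gt0.
transitivity ((C `^ q * ((2 / 3) `^ (- f) * (2 `^ nn * dyadic_const nn (nn - f) * nn^-1 `^ f))) * (m y `^ (- f) * m y `^ f)).
  ring.
by rewrite E mulr1.
Qed.

Lemma bounded_near : bounded_kernel mu p q (near_kernel d m (beta / p) Th).
Proof.
exists B => // g mg g0.
have bp : beta / p != 0 by rewrite gt_eqF ?divr_gt0.
have E x y : near_kernel d m (beta / p) Th (x, y) = K1 (x, y) * K2 (x, y).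
  rewrite /near_kernel /riesz_kernel /K1 /K2 /near /=.
  have [xy|] := boolP (0 < _ <= _); last by rewrite !mul0r.
  have [dx|dx] := ltP 0 (d x); last first.
    have /eqP -> : d x == 0 by rewrite eq_le dx d_ge0.
    by rewrite mul0r mulr0 powR0// !mul0r mulr0.
  case/andP: xy => r00 _; rewrite !mul1r.
  have -> : 1 - nn = - (nn / q - Th / 2) + - b.
    by rewrite /b np' /Th; field; rewrite !gt_eqF.
  rewrite [X in _ * X = _]powRD ?(gt_eqF r00) ?implybT//; ring.
under eq_integral do under eq_integral do rewrite E.
have mA : measurable_fun [set: 'rV[R]_n] A.
  apply: measurable_funM => //; apply: measurable_funM; exact: measurable_powR_comp.
apply: (schur p0 p'0 pp' pq mK1 mK2 mA K1_ge0 K2_ge0 _ B0 HK2 HK1 mg g0).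
by move=> x; rewrite !mulr_ge0 ?powR_ge0.
Qed.

End near.

(** The far part.  The exponent a is chosen so that d^-s m^-(a p') <= d^-alpha,
    whose integral over the set where m <= r grows at most like r^(n - alpha).
    Beyond m(x) the integral of K2^p' converges since s > 0.  In x, small values
    of m are integrable since q Th < n and large ones since a > 0. *)
Section far.

Let a := (alpha - s) / p'.
Let a0 : 0 < a. Proof. by rewrite divr_gt0// subr_gt0. Qed.
Let ap' : a * p' = alpha - s. Proof. by rewrite divfK// gt_eqF. Qed.
Let M (z : 'rV[R]_n * 'rV[R]_n) : R := Num.max (m z.1) (m z.2).
Let K1 z : R :=
  m z.1 `^ (beta / p - Th) * m z.2 `^ a * M z `^ (- (nn / p - 1 + a)).
Let K2 z : R := d z.2 `^ (- (beta / p)) * m z.2 `^ (- a) * M z `^ (- (nn / p' - a)).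

Let mM : measurable_fun [set: _] M.
Proof. exact: measurable_maxr. Qed.

Let mK1 : measurable_fun [set: _] K1.
Proof.
apply: measurable_funM; last exact: measurable_powR_comp.
by apply: measurable_funM; exact: measurable_powR_comp.
Qed.

Let mK2 : measurable_fun [set: _] K2.
Proof.
apply: measurable_funM; last exact: measurable_powR_comp.
by apply: measurable_funM; exact: measurable_powR_comp.
Qed.

Let K1_ge0 z : 0 <= K1 z.
Proof. by rewrite /K1 !mulr_ge0 ?powR_ge0. Qed.

Let K2_ge0 z : 0 <= K2 z.
Proof. by rewrite /K2 !mulr_ge0 ?powR_ge0. Qed.

Let c := nn - (alpha - s).
Let Nc : nn - alpha < c. Proof. by rewrite /c ltrD2l ltrN2 gtrBl. Qed.
Let dc := dyadic_const (nn - alpha) c.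
Let dc0 : 0 < dc. Proof. by rewrite /dc dyadic_const_gt0// lt_eqF. Qed.
Let C := (K * (1 + dc)) `^ p'^-1.
Let A x := C * m x `^ (- (beta / p)).
Let C_ge0 : 0 <= C. Proof. exact: powR_ge0. Qed.
Let A_ge0 x : 0 <= A x. Proof. by rewrite mulr_ge0// powR_ge0. Qed.

Let dm_le y : d y `^ (- s) * m y `^ (- (alpha - s)) <= d y `^ (- alpha).
Proof.
have [dy0|dyn0] := eqVneq (d y) 0.
  by rewrite dy0 powR0 ?oppr_eq0 ?(gt_eqF s0)// mul0r powR_ge0.
have dy0 : 0 < d y by rewrite lt_neqAle eq_sym dyn0 d_ge0.
have -> : - alpha = - s + - (alpha - s) by ring.
rewrite powRD ?dyn0 ?implybT//; apply: ler_wpM2l; first exact: powR_ge0.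
apply: le_powRN => //; first by rewrite subr_ge0 ltW.
by rewrite /m lerDl ltW.
Qed.

Let HK2 x : (\int[mu]_y (K2 (x, y) `^ p')%:E <= (A x `^ p')%:E)%E.
Proof.
pose w y := d y `^ (- alpha).
have mw : measurable_fun [set: 'rV[R]_n] w by exact: measurable_powR_comp.
have w0 y : 0 <= w y by exact: powR_ge0.
have alpha0 : 0 <= alpha by rewrite ltW// (lt_trans s0).
have gw r : 0 < r ->
    (\int[mu]_y ((m y <= r)%R%:R * w y)%:E <= (K * r `^ (nn - alpha))%:E)%E.
  by move=> hr; exact: hB.
have mle r : measurable_fun [set: 'rV[R]_n] (fun y => (m y <= r)%R%:R : R).
  by apply: measurable_boolR; apply: measurable_fun_ler => //; exact: measurable_cst.
have mlt r : measurable_fun [set: 'rV[R]_n] (fun y => (r < m y)%R%:R : R).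
  by apply: measurable_boolR; apply: measurable_fun_ltr => //; exact: measurable_cst.
have E y : K2 (x, y) `^ p' <= m x `^ (- c) * ((m y <= m x)%R%:R * w y) +
    (m x < m y)%R%:R * (m y `^ (- c) * w y).
  rewrite /K2 /= powRM ?mulr_ge0 ?powR_ge0// powRM ?powR_ge0// -!powRrM.
  rewrite !mulNr -/s ap' (_ : (nn / p' - a) * p' = c); last first.
    by rewrite mulrBl ap' divfK// gt_eqF.
  apply: (@le_trans _ _ (w y * M (x, y) `^ (- c))).
    by apply: ler_wpM2r; [exact: powR_ge0|exact: dm_le].
  rewrite /M /=; have [yx|xy] := leP (m y) (m x).
    by rewrite mul1r mul0r addr0 mulrC.
  by rewrite mul0r mulr0 add0r mul1r mulrC.
apply: (@le_trans _ _ (\int[mu]_y ((m x `^ (- c))%:E * ((m y <= m x)%R%:R * w y)%:E +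
    ((m x < m y)%R%:R * (m y `^ (- c) * w y))%:E))%E).
  apply: le_integral_ge0 => y; first by rewrite lee_fin powR_ge0.
  by rewrite -EFinM -EFinD lee_fin; exact: E.
rewrite ge0_integralD//; last 4 first.
- by move=> y _; rewrite -EFinM lee_fin !mulr_ge0 ?powR_ge0.
- by apply/measurable_EFinP; do 2 apply: measurable_funM => //.
- by move=> y _; rewrite lee_fin !mulr_ge0 ?powR_ge0.
- apply/measurable_EFinP; apply: measurable_funM => //; apply: measurable_funM => //.
  exact: measurable_powR_comp.
rewrite ge0_integralZl ?lee_fin ?powR_ge0//; last 2 first.
- by apply/measurable_EFinP; apply: measurable_funM.
- by move=> y _; rewrite lee_fin mulr_ge0.
have I2 := @tail_power_integral _ _ R mu m w mm mw w0 K (nn - alpha) c (ltW K0)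
  (m x) (m0 x) Nc (fun r hr => gw r (lt_le_trans (m0 x) hr)).
apply: (@le_trans _ _ ((m x `^ (- c))%:E * (K * m x `^ (nn - alpha))%:E +
   (K * dc * m x `^ (nn - alpha - c))%:E)%E).
  by rewrite leeD// lee_wpmul2l ?lee_fin ?powR_ge0//; exact: gw.
rewrite -EFinM -EFinD lee_fin mulrCA -powRD ?(gt_eqF (m0 x)) ?implybT//.
rewrite /A powRM ?powR_ge0// -!powRrM mulVf ?(gt_eqF p'0)// powRr1; last first.
  by rewrite mulr_ge0 ?(ltW K0)// addr_ge0// ltW.
rewrite mulNr -/s (_ : - c + (nn - alpha) = - s); last by rewrite /c; ring.
rewrite (_ : nn - alpha - c = - s); last by rewrite /c; ring.
by rewrite le_eqVlt; apply/orP; left; apply/eqP; ring.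
Qed.

Let h := q * (nn / p - 1 + a).
Let qTh : q * Th < nn.
Proof.
have : 0 < q * (nn / p - 1).
  by rewrite mulr_gt0// subr_gt0 ltr_pdivlMr// mul1r.
by rewrite np mulrBr mulrCA divff ?(gt_eqF q0)// mulr1 subr_gt0.
Qed.
Let qnp : q * (nn / p - 1) = nn - q * Th.
Proof. by rewrite np mulrBr mulrCA divff ?(gt_eqF q0)// mulr1. Qed.
Let qa0 : 0 < q * a. Proof. by rewrite mulr_gt0. Qed.

Let dc1 := dyadic_const nn (q * Th).
Let dc2 := dyadic_const nn (nn + q * a).
Let dc10 : 0 < dc1. Proof. by rewrite dyadic_const_gt0// gt_eqF. Qed.
Let dc20 : 0 < dc2. Proof. by rewrite dyadic_const_gt0// lt_eqF// ltrDl. Qed.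

Let B := C `^ q * (2 `^ nn * (dc1 + dc2)) + 1.
Let B0 : 0 < B.
Proof.
by rewrite /B ltr_wpDl// mulr_ge0 ?powR_ge0// mulr_ge0 ?powR_ge0// addr_ge0// ltW.
Qed.

Let HK1 y : (\int[mu]_x ((A x * K1 (x, y)) `^ q)%:E <= B%:E)%E.
Proof.
have mle : measurable_fun [set: 'rV[R]_n] (fun x => (0 < m x <= m y)%R%:R : R).
  apply: measurable_boolR; apply: measurable_and.
    by apply: measurable_fun_ltr => //; exact: measurable_cst.
  by apply: measurable_fun_ler => //; exact: measurable_cst.
have mlt : measurable_fun [set: 'rV[R]_n] (fun x => (m y < m x)%R%:R : R).
  by apply: measurable_boolR; apply: measurable_fun_ltr => //; exact: measurable_cst.
have E x : (A x * K1 (x, y)) `^ q <=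
    C `^ q * (m y `^ (- (nn - q * Th))) *
      ((0 < m x <= m y)%R%:R * (m x `^ (- (q * Th)) * 1)) +
    C `^ q * m y `^ (q * a) * ((m y < m x)%R%:R * (m x `^ (- (nn + q * a)) * 1)).
  have -> : A x * K1 (x, y) =
      C * (m x `^ (- Th) * (m y `^ a * M (x, y) `^ (- (nn / p - 1 + a)))).
    have -> : m x `^ (- Th) = m x `^ (- (beta / p)) * m x `^ (beta / p - Th).
      rewrite -powRD ?(gt_eqF (m0 x)) ?implybT//; congr (_ `^ _); ring.
    by rewrite /A /K1 /=; ring.
  rewrite powRM ?mulr_ge0 ?powR_ge0// powRM ?mulr_ge0 ?powR_ge0//.
  rewrite [(m y `^ a * _) `^ _]powRM ?powR_ge0// -!powRrM !mulNr [Th * _]mulrC.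
  rewrite [a * q]mulrC [(_ - 1 + a) * q]mulrC -/h.
  have hE : h = nn - q * Th + q * a by rewrite -qnp /h; ring.
  rewrite m0 /M /= le_eqVlt; apply/orP; left; apply/eqP.
  have [xy|yx] := leP (m x) (m y).
    rewrite mul0r mulr0 addr0 mul1r mulr1.
    have -> : - (nn - q * Th) = q * a + - h by rewrite hE; ring.
    rewrite [m y `^ (_ + _)]powRD ?(gt_eqF (m0 y)) ?implybT//; ring.
  rewrite mul0r mulr0 add0r mul1r mulr1.
  have -> : - (nn + q * a) = - (q * Th) + - h by rewrite hE; ring.
  rewrite [m x `^ (_ + _)]powRD ?(gt_eqF (m0 x)) ?implybT//; ring.
apply: (@le_trans _ _ (\int[mu]_x ((C `^ q * (m y `^ (- (nn - q * Th))))%:E *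
      ((0 < m x <= m y)%R%:R * (m x `^ (- (q * Th)) * 1))%:E +
    (C `^ q * m y `^ (q * a))%:E *
      ((m y < m x)%R%:R * (m x `^ (- (nn + q * a)) * 1))%:E))%E).
  apply: le_integral_ge0 => x; first by rewrite lee_fin powR_ge0.
  by rewrite -!EFinM -EFinD lee_fin; exact: E.
have mI1 : measurable_fun [set: 'rV[R]_n]
    (fun x => (0 < m x <= m y)%R%:R * (m x `^ (- (q * Th)) * 1) : R).
  by apply: measurable_funM => //; apply: measurable_funM => //; exact: measurable_powR_comp.
have mI2 : measurable_fun [set: 'rV[R]_n]
    (fun x => (m y < m x)%R%:R * (m x `^ (- (nn + q * a)) * 1) : R).
  by apply: measurable_funM => //; apply: measurable_funM => //; exact: measurable_powR_comp.
rewrite ge0_integralD//; last 4 first.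
- by move=> x _; rewrite -EFinM lee_fin !mulr_ge0 ?powR_ge0.
- by apply/measurable_EFinP; apply: measurable_funM.
- by move=> x _; rewrite -EFinM lee_fin !mulr_ge0 ?powR_ge0.
- by apply/measurable_EFinP; apply: measurable_funM.
rewrite ge0_integralZl; last 4 first.
- by [].
- exact/measurable_EFinP.
- by move=> x _; rewrite lee_fin !mulr_ge0 ?powR_ge0.
- by rewrite lee_fin mulr_ge0 ?powR_ge0.
rewrite ge0_integralZl; last 4 first.
- by [].
- exact/measurable_EFinP.
- by move=> x _; rewrite lee_fin !mulr_ge0 ?powR_ge0.
- by rewrite lee_fin mulr_ge0 ?powR_ge0.
have nqa : nn < nn + q * a by rewrite ltrDl.
have I1 := @inner_power_integral _ _ R mu m (fun=> 1 : R) mm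
  (measurable_cst (1 : R)) (fun=> ler01) (2 `^ nn) nn (q * Th)
  (powR_ge0 _ _) (m y) (m0 y) qTh (fun r hr _ => m_growth (ltW hr)).
have I2 := @tail_power_integral _ _ R mu m (fun=> 1 : R) mm
  (measurable_cst (1 : R)) (fun=> ler01) (2 `^ nn) nn (nn + q * a)
  (powR_ge0 _ _) (m y) (m0 y) nqa
  (fun r hr => m_growth (ltW (lt_le_trans (m0 y) hr))).
apply: (le_trans (leeD (lee_wpmul2l _ I1) (lee_wpmul2l _ I2))).
- by rewrite lee_fin mulr_ge0 ?powR_ge0.
- by rewrite lee_fin mulr_ge0 ?powR_ge0.
rewrite -!EFinM -EFinD lee_fin -/dc1 -/dc2.
have E1 : m y `^ (- (nn - q * Th)) * m y `^ (nn - q * Th) = 1.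
  by rewrite powRN mulVf// gt_eqF// powR_gt0.
have E2 : m y `^ (q * a) * m y `^ (nn - (nn + q * a)) = 1.
  rewrite -powRD ?(gt_eqF (m0 y)) ?implybT//.
  by rewrite (_ : _ + _ = 0) ?powRr0//; ring.
rewrite /B -[leLHS]addr0 lerD// le_eqVlt; apply/orP; left; apply/eqP.
transitivity (C `^ q * (2 `^ nn * dc1) * (m y `^ (- (nn - q * Th)) * m y `^ (nn - q * Th)) +
  C `^ q * (2 `^ nn * dc2) * (m y `^ (q * a) * m y `^ (nn - (nn + q * a)))).
  ring.
rewrite E1 E2; ring.
Qed.

Lemma bounded_far : bounded_kernel mu p q (far_kernel d m (beta / p) Th).
Proof.
exists B => // g mg g0.
have E x y : far_kernel d m (beta / p) Th (x, y) = K1 (x, y) * K2 (x, y).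
  rewrite /far_kernel /K1 /K2 /= -/(M (x, y)).
  have M0 : 0 < M (x, y) by rewrite /M /= lt_max m0.
  have -> : 1 - nn = - (nn / p - 1 + a) + - (nn / p' - a) by rewrite np'; ring.
  rewrite [X in _ * X = _]powRD ?(gt_eqF M0) ?implybT//.
  have ma : m y `^ a * m y `^ (- a) = 1.
    by rewrite powRN divff// gt_eqF// powR_gt0.
  rewrite -[LHS]mulr1 -[X in _ * X = _]ma; ring.
under eq_integral do under eq_integral do rewrite E.
have mA : measurable_fun [set: 'rV[R]_n] A.
  by apply: measurable_funM => //; exact: measurable_powR_comp.
exact: (schur p0 p'0 pp' pq mK1 mK2 mA K1_ge0 K2_ge0 A_ge0 B0 HK2 HK1 mg g0).
Qed.

End far.

(** The kernel is dominated by its near part plus a multiple of the far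
    kernel. *)
Lemma bounded_riesz :
  bounded_kernel mu p q (riesz_kernel d m (beta / p) Th).
Proof.
have [B1 B10 h1] := bounded_near; have [B2 B20 h2] := bounded_far.
set k1 := near_kernel _ _ _ _ in h1; set k2 := far_kernel _ _ _ _ in h2.
pose c := (3 * nn) `^ (nn - 1).
have c0 : 0 <= c by exact: powR_ge0.
have bp : 0 < beta / p by rewrite divr_gt0.
have mk0 : measurable_fun [set: _] (riesz_kernel d m (beta / p) Th).
  apply: measurable_funM; last exact: measurable_powR_comp.
  apply: measurable_funM; last exact: measurable_powR_comp.
  by apply: measurable_funM; exact: measurable_powR_comp.
have mk1 : measurable_fun [set: _] k1.
  apply: measurable_funM => //; apply: measurable_boolR; apply: measurable_and.
    by apply: measurable_fun_ltr => //; exact: measurable_cst.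
  by apply: measurable_fun_ler => //; apply: measurable_funM => //; exact: measurable_cst.
have mk2 : measurable_fun [set: _] k2.
  apply: measurable_funM; last exact/measurable_powR_comp/measurable_maxr.
  by apply: measurable_funM; exact: measurable_powR_comp.
exists (2 `^ q * (B1 + c `^ q * B2)).
  by rewrite mulr_gt0 ?powR_gt0// ltr_pwDl// mulr_ge0 ?powR_ge0 ?(ltW B20).
move=> g mg g0.
have mI (k : 'rV[R]_n * 'rV[R]_n -> R) : measurable_fun [set: _] k -> (forall z, 0 <= k z) ->
    measurable_fun [set: 'rV[R]_n] (fun x => (\int[mu]_y (k (x, y) * g y)%:E)%E).
  move=> mk k0.
  apply: (measurable_fun_fubini_tonelli_F (fun z => (k z * g z.2)%:E)).
    apply/measurable_EFinP; apply: measurable_funM => //.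
    exact: (measurableT_comp mg measurable_snd).
  by move=> z; rewrite lee_fin mulr_ge0.
have I0 (k : 'rV[R]_n * 'rV[R]_n -> R) x : (forall z, 0 <= k z) -> (0 <= \int[mu]_y (k (x, y) * g y)%:E)%E.
  by move=> k0; apply: integral_ge0 => y _; rewrite lee_fin mulr_ge0.
have k10 z : 0 <= k1 z by exact: near_kernel_ge0.
have k20 z : 0 <= k2 z by exact: far_kernel_ge0.
have mIq (k : 'rV[R]_n * 'rV[R]_n -> R) : measurable_fun [set: _] k -> (forall z, 0 <= k z) ->
    measurable_fun [set: 'rV[R]_n] (fun x => ((\int[mu]_y (k (x, y) * g y)%:E) `^ q)%E).
  by move=> mk k0; apply: measurable_poweR_comp => //; [exact: mI|move=> x; exact: I0].
apply: (@le_trans _ _ (\int[mu]_x ((2 `^ q)%:E * ((\int[mu]_y (k1 (x, y) * g y)%:E) `^ q +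
   (c `^ q)%:E * (\int[mu]_y (k2 (x, y) * g y)%:E) `^ q)))%E).
  apply: le_integral_ge0 => x; first exact: poweR_ge0.
  rewrite -[((c `^ q)%:E * _)%E](@poweRM _ c%:E _ q) ?lee_fin ?I0//.
  apply: le_trans (poweRD_le (ltW q0) _ _); last 2 first.
  - exact: I0.
  - by rewrite mule_ge0 ?lee_fin ?I0.
  apply: gt0_ler_poweR; rewrite ?(ltW q0) ?in_itv/= ?leey ?andbT//.
  - by apply: I0 => z; exact: riesz_kernel_ge0.
  - by rewrite adde_ge0 ?I0// mule_ge0 ?lee_fin ?I0.
  rewrite -ge0_integralZl//; last 2 first.
  - apply/measurable_EFinP; apply: measurable_funM => //.
    exact: (measurableT_comp mk2 (measurable_pair1 x)).
  - by move=> y _; rewrite lee_fin mulr_ge0.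
  rewrite -ge0_integralD//; last 4 first.
  - by move=> y _; rewrite lee_fin mulr_ge0.
  - apply/measurable_EFinP; apply: measurable_funM => //.
    exact: (measurableT_comp mk1 (measurable_pair1 x)).
  - by move=> y _; apply: mule_ge0; rewrite lee_fin //; apply: mulr_ge0.
  - apply/measurable_EFinP; apply: measurable_funM => //; apply: measurable_funM => //.
    exact: (measurableT_comp mk2 (measurable_pair1 x)).
  apply: le_integral_ge0 => y; first by rewrite lee_fin mulr_ge0// riesz_kernel_ge0.
  rewrite -EFinM -EFinD lee_fin [c * _]mulrA -mulrDl; apply: ler_wpM2r => //.
  apply: riesz_kernel_le => //; first by rewrite /= /m lerDl ltW.
  by have := dL y x; rewrite /m /=; lra.
rewrite ge0_integralZl; last 4 first.
- by [].
- apply: emeasurable_funD; first exact: mIq.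
  apply: emeasurable_funM; first exact: measurable_cst.
  exact: mIq.
- by move=> x _; rewrite adde_ge0 ?poweR_ge0// mule_ge0 ?lee_fin ?powR_ge0 ?poweR_ge0.
- by rewrite lee_fin powR_ge0.
rewrite ge0_integralD; last 5 first.
- by [].
- by move=> x _; exact: poweR_ge0.
- exact: mIq.
- by move=> x _; rewrite mule_ge0 ?lee_fin ?powR_ge0 ?poweR_ge0.
- by apply: emeasurable_funM; [exact: measurable_cst|exact: mIq].
rewrite ge0_integralZl; last 4 first.
- by [].
- exact: mIq.
- by move=> x _; exact: poweR_ge0.
- by rewrite lee_fin powR_ge0.
rewrite EFinM -muleA lee_wpmul2l ?lee_fin ?powR_ge0// EFinD EFinM.
rewrite ge0_muleDl ?lee_fin ?mule_ge0 ?lee_fin ?powR_ge0 ?(ltW B10) ?(ltW B20)//.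
rewrite leeD ?h1// -muleA lee_wpmul2l ?lee_fin ?powR_ge0//.
  exact: h2.
by rewrite mulr_ge0 ?powR_ge0 ?(ltW B20).
Qed.

End kernels.

(** * The inequality away from E *)

(** If d >= k r0 and k < 1 then d + r0 <= (2 / k) d. *)
Lemma far_dist_le (R : realType) (d r0 k Th : R) : 0 < r0 -> 0 < k -> k < 1 ->
  0 <= Th -> k * r0 <= d ->
  d `^ (- Th) <= 2 `^ Th * k `^ (- Th) * (d + r0) `^ (- Th).
Proof.
move=> r00 k0 k1 Th0 kd.
have d0 : 0 < d by rewrite (lt_le_trans _ kd)// mulr_gt0.
have dr0 : 0 < d + r0 by rewrite addr_gt0.
have -> : 2 `^ Th * k `^ (- Th) * (d + r0) `^ (- Th) = (2^-1 * k * (d + r0)) `^ (- Th).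
  rewrite [RHS]powRM ?mulr_ge0 ?invr_ge0 ?(ltW k0) ?(ltW dr0)//; congr (_ * _).
  rewrite [RHS]powRM ?invr_ge0 ?(ltW k0)//; congr (_ * _).
  have -> : 2^-1 = 2 `^ (- 1) :> R by rewrite powR_inv1.
  by rewrite -powRrM mulrNN mul1r.
apply: le_powRN => //; first by rewrite !mulr_gt0// invr_gt0.
have : k * d <= d by rewrite ger_pMl// ltW.
by rewrite mulrDr -mulrA; lra.
Qed.

Theorem theorem1p10 (R : realType) (n : nat) (p q beta : R)
    (E : set 'rV[R]_n)
    (hn : (1 < n)%N) (hp : 1 < p) (hpq : p <= q)
    (hTheta : 0 < Theta1 n p q) (hq : q < n%:R / Theta1 n p q)
    (hE : weakly_porous E)
    (hdiam0 : (0 < diam E)%E) (hdiam : (diam E < +oo)%E)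
    (hbeta : 0 < beta)
    (hMu : ((beta * conj_exp p / p)%:E < Mu1 E)%E) :
  exists C : R, 0 < C /\
    forall (f : 'rV[R]_n -> R) (kappa : R),
      C10 f -> 0 < kappa -> kappa < 1 ->
      ((\int[lebesgue_rV R n]_(x in far_set E kappa)
          ((`|f x| `^ q)%:E *
           dist_pow E (q * (n%:R - p + beta) / p - n%:R) x)) `^ (q^-1)
       <= C%:E * (kappa `^ (- Theta1 n p q))%:E *
          (\int[lebesgue_rV R n]_x
             ((enorm (gradient f x) `^ p)%:E * dist_pow E beta x))
          `^ (p^-1))%E.
Proof.
have [[x0 Ex0] _] := hE.
have E0 : E !=set0 by exists x0.
have n0 : (0 < n)%N by exact: ltnW.
have nn0 : 0 < n%:R :> R by rewrite ltr0n.
pose Th := Theta1 n p q.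
have p0 : 0 < p by exact: lt_trans hp.
have q0 : 0 < q by exact: lt_le_trans hpq.
have pn : p < n%:R.
  move: hq; rewrite ltr_pdivlMr// /Theta1 mulrDr mulr1.
  have -> : q * (n%:R * (q^-1 - p^-1)) = n%:R - n%:R * q / p.
    by field; rewrite !gt_eqF.
  rewrite addrCA -[ltRHS]addr0 ltrD2l subr_lt0 ltr_pdivlMr// mulrC.
  by rewrite ltr_pM2r.
pose r0 := fine (diam E).
have diamE : diam E = r0%:E by rewrite fineK// gt0_fin_numE.
have r0_gt0 : 0 < r0 by rewrite -lte_fin -diamE.
have Er0 y : E y -> enorm (y - x0) <= r0.
  move=> Ey; rewrite -lee_fin -diamE; apply: ereal_sup_ubound.
  by exists y => //; exists x0.
have [_ [alpha [alpha0 A1E] <-]] := ereal_sup_gt hMu.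
rewrite lte_fin => salpha.
pose d := dist ^~ E.
have md : measurable_fun [set: 'rV[R]_n] d by exact: measurable_dist.
have d_ge0 x : 0 <= d x by exact: dist_ge0.
have [K1 K10 hA] := A1_power_integral E0 alpha0 A1E.
have [K2 K20 hB] := A1_power_growth E0 alpha0 A1E Er0 n0.
have dnull := dist0_negligible E0 alpha0 A1E r0_gt0 Er0 n0.
have [B B0 hker] : bounded_kernel (lebesgue_rV R n) p q
    (riesz_kernel d (fun x => d x + r0) (beta / p) Th).
  apply: (@bounded_riesz R n d r0 p q beta alpha (K1 + K2) x0) => //.
  - by move=> x y; exact: dist_lipschitz.
  - by move=> x; exact: sup_norm_le_dist.
  - by rewrite addr_gt0.
  - move=> t t0 ta x r dx hr; apply: (le_trans (hA t t0 ta x r dx hr)).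
    rewrite lee_fin; apply: ler_wpM2r; first exact: powR_ge0.
    by apply: ler_wpM2r; [exact: powR_ge0|rewrite lerDl ltW].
  - move=> t t0 ta r hr; apply: (le_trans (hB t t0 ta r hr)).
    by rewrite lee_fin; apply: ler_wpM2r; [exact: powR_ge0|rewrite lerDr ltW].
  - by move: salpha; rewrite /conj_exp mulrAC.
pose C0 : R := n%:R * 2 ^+ n.
have C00 : 0 < C0 by rewrite mulr_gt0// exprn_gt0.
exists (B `^ q^-1 * (2 `^ Th * C0)); split.
  by rewrite !mulr_gt0 ?powR_gt0.
move=> f k C10f k0 k1.
pose c := 2 `^ Th * C0 * k `^ (- Th).
have c0 : 0 < c by rewrite !mulr_gt0 ?powR_gt0.
(* The constant is put into g, so that no factor has to leave the outer
   integral. *)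
pose g y := c * (enorm (gradient f y) * d y `^ (beta / p)).
have g0 y : 0 <= g y by rewrite /g mulr_ge0 ?(ltW c0)// mulr_ge0 ?powR_ge0 ?enorm_ge0.
have mgrad := measurable_enorm_gradient C10f.
have mg : measurable_fun [set: 'rV[R]_n] g.
  apply: measurable_funM => //; apply: measurable_funM => //.
  exact: measurable_powR_comp.
pose G := (\int[lebesgue_rV R n]_x
             ((enorm (gradient f x) `^ p)%:E * dist_pow E beta x))%E.
have G0 : (0 <= G)%E.
  apply: integral_ge0 => y _; rewrite mule_ge0 ?lee_fin ?powR_ge0//.
  exact: dist_pow_ge0.
have Gg : (\int[lebesgue_rV R n]_y (g y `^ p)%:E = (c `^ p)%:E * G)%E.
  have dpE y : dist_pow E beta y = (d y `^ beta)%:E.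
    by rewrite /dist_pow ltNge (ltW hbeta) andbF.
  rewrite /G -ge0_integralZl; last 4 first.
  - by [].
  - under eq_fun do rewrite dpE.
    apply/measurable_EFinP; apply: measurable_funM.
      exact: (measurable_powR_comp p mgrad).
    exact: (measurable_powR_comp beta md).
  - by move=> y _; rewrite mule_ge0 ?lee_fin ?powR_ge0// dist_pow_ge0.
  - by rewrite lee_fin powR_ge0.
  apply: eq_integral => y _; rewrite dpE -!EFinM; congr EFin.
  rewrite /g powRM ?(ltW c0) ?mulr_ge0 ?powR_ge0 ?enorm_ge0//.
  rewrite powRM ?powR_ge0 ?enorm_ge0// -[X in _ * (_ * X) = _]powRrM.
  by rewrite divfK// gt_eqF.
have key x : far_set E k x -> (`|f x|%:E * (d x `^ (beta / p - Th))%:E <=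
    \int[lebesgue_rV R n]_y
      (riesz_kernel d (fun x => d x + r0) (beta / p) Th (x, y) * g y)%:E)%E.
  move=> Fx; have kd : k * r0 <= d x.
    by move: Fx; rewrite /far_set /= diamE -EFinM lee_fin.
  have dx0 : 0 < d x by rewrite (lt_le_trans _ kd)// mulr_gt0.
  have hfar := far_dist_le r0_gt0 k0 k1 (ltW hTheta) kd.
  pose l := d x `^ (beta / p) * (d x + r0) `^ (- Th).
  have l0 : 0 <= l by rewrite mulr_ge0 ?powR_ge0.
  pose h y := enorm (gradient f y) * `|y - x| `^ (1 - n%:R).
  have h0 y : 0 <= h y by rewrite mulr_ge0 ?powR_ge0 ?enorm_ge0.
  have mnx : measurable_fun [set: 'rV[R]_n] (fun y => `|y - x|).
    by apply: measurable_normB => //; exact: measurable_cst.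
  have mh : measurable_fun [set: 'rV[R]_n] h.
    by apply: measurable_funM => //; exact: measurable_powR_comp.
  apply: (@le_trans _ _ (`|f x|%:E * (2 `^ Th * k `^ (- Th) * l)%:E)%E).
    apply: lee_wpmul2l; first by rewrite lee_fin.
    rewrite lee_fin powRD ?(gt_eqF dx0) ?implybT// /l mulrCA.
    by apply: ler_wpM2l; [exact: powR_ge0|exact: hfar].
  have e0 : 0 <= 2 `^ Th * k `^ (- Th) * l by rewrite !mulr_ge0 ?powR_ge0.
  apply: (@le_trans _ _ ((C0%:E * \int[lebesgue_rV R n]_y (h y)%:E) *
     (2 `^ Th * k `^ (- Th) * l)%:E)%E).
    apply: lee_wpmul2r; first by rewrite lee_fin.
    exact: riesz_representation.
  rewrite muleC muleA -EFinM -ge0_integralZl; last 4 first.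
  - by [].
  - exact/measurable_EFinP.
  - by move=> y _; rewrite lee_fin.
  - by rewrite lee_fin mulr_ge0 ?(ltW C00).
  rewrite le_eqVlt; apply/orP; left; apply/eqP.
  apply: ge0_ae_eq_integral => //.
  - by apply/measurable_EFinP; exact: measurable_funM.
  - apply/measurable_EFinP; apply: measurable_funM => //.
    rewrite /riesz_kernel /=.
    apply: measurable_funM; last exact: (measurable_powR_comp _ mnx).
    by apply: measurable_funM; [exact: measurable_cst|exact: (measurable_powR_comp _ md)].
  - by move=> y _; rewrite -EFinM lee_fin mulr_ge0// mulr_ge0// ltW.
  - by move=> y _; rewrite lee_fin mulr_ge0// riesz_kernel_ge0.
  (* the two integrands agree where d(y) > 0 *)
  exists [set y : 'rV[R]_n | d y = 0]; split => //.
    by have := md measurableT _ (measurable_set1 0); rewrite setTI.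
  move=> y /= hy; apply: contrapT => dy; apply: hy => _.
  rewrite -EFinM; congr EFin; rewrite /riesz_kernel /g /h /= -/l.
  have dd : d y `^ (- (beta / p)) * d y `^ (beta / p) = 1.
    by rewrite powRN mulVf// powR_eq0; apply/negP => /andP[/eqP].
  transitivity (2 `^ Th * k `^ (- Th) * l * C0 * (enorm (gradient f y) * `|y - x| `^ (1 - n%:R)) *
    (d y `^ (- (beta / p)) * d y `^ (beta / p))).
    by rewrite dd mulr1.
  rewrite /c; ring.
have farE x : far_set E k x ->
    ((`|f x| `^ q)%:E * dist_pow E (q * (n%:R - p + beta) / p - n%:R) x =
     (`|f x|%:E * (d x `^ (beta / p - Th))%:E) `^ q)%E.
  move=> Fx; have kd : k * r0 <= d x.
    by move: Fx; rewrite /far_set /= diamE -EFinM lee_fin.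
  have dx0 : 0 < d x by rewrite (lt_le_trans _ kd)// mulr_gt0.
  rewrite /dist_pow (gt_eqF dx0) andFb poweRM ?lee_fin ?powR_ge0// !poweR_EFin -powRrM.
  congr (_ * (_ `^ _)%:E)%E; rewrite /Th /Theta1.
  by field; rewrite !gt_eqF.
have main : (\int[lebesgue_rV R n]_(x in far_set E k)
          ((`|f x| `^ q)%:E *
           dist_pow E (q * (n%:R - p + beta) / p - n%:R) x) <=
    B%:E * ((c `^ p)%:E * G) `^ (q / p))%E.
  rewrite -Gg; apply: le_trans (hker g mg g0).
  rewrite [leLHS]integral_mkcond; apply: le_integral_ge0 => x.
    rewrite patchE; case: ifPn => // _.
    by rewrite mule_ge0 ?lee_fin ?powR_ge0// dist_pow_ge0.
  rewrite patchE; case: ifPn => [|_]; last exact: poweR_ge0.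
  rewrite inE => Fx; rewrite farE//.
  apply: gt0_ler_poweR (key x Fx); rewrite ?(ltW q0)// in_itv/= leey andbT.
    by rewrite mule_ge0 ?lee_fin ?powR_ge0.
  by apply: integral_ge0 => y _; rewrite lee_fin mulr_ge0// riesz_kernel_ge0.
apply: (@le_trans _ _ ((B%:E * ((c `^ p)%:E * G) `^ (q / p)) `^ q^-1)%E).
  apply: gt0_ler_poweR main; rewrite ?invr_ge0 ?(ltW q0)// in_itv/= leey andbT.
    apply: integral_ge0 => x _.
    by rewrite mule_ge0 ?lee_fin ?powR_ge0// dist_pow_ge0.
  by rewrite mule_ge0 ?poweR_ge0 ?lee_fin ?(ltW B0).
rewrite poweRM ?lee_fin ?(ltW B0) ?poweR_ge0// -poweRrM.
rewrite (_ : q / p * q^-1 = p^-1); last by field; rewrite !gt_eqF.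
rewrite poweRM ?lee_fin ?powR_ge0// !poweR_EFin -powRrM divff ?gt_eqF//.
rewrite powRr1 ?(ltW c0)// muleA -!EFinM /c.
by rewrite !mulrA.
Qed.
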